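(* Let $(X,d)$ be a proper Polish space and let $\mu\in\mathcal{W}_2(X)$. Consider a decomposition $\mu=\lambda\mu^1+(1-\lambda)\mu^2$ with $\lambda\in(0,1)$ and $\mu^1,\mu^2$ probability measures on $X$, let $\mathcal{R}^1,\mathcal{R}^2:\mathcal{W}_2(X)\to\mathcal{W}_2(X)$ be the associated restriction mappings, and let $\mathbb{P}\in\mathcal{W}_2(\mathcal{W}_2(X))$. Then, for $i\in\{1,2\}$, if $\mu$ is a barycenter of $\mathbb{P}$, then $\mu^i$ is a barycenter of $\mathbb{Q}^i:=\mathcal{R}^i_{\#}\mathbb{P}$.
   Context: A metric space is proper if its closed balls are compact, and Polish if it is complete and separable. $\mathcal{W}_2(X)$ is the space of Borel probability measures on $X$ with finite second order moment, with the quadratic Wasserstein distance $d_W(\mu,\nu)=\left(\min_{\pi\in\Gamma(\mu,\nu)}\int d^2(x,y)\,d\pi(x,y)\right)^{1/2}$, where $\Gamma(\mu,\nu)$ is the set of couplings; $\Gamma^o(\mu,\nu)$ denotes the set of optimal couplings. $\mathcal{W}_2(\mathcal{W}_2(X))$ is the same construction over $(\mathcal{W}_2(X),d_W)$. A barycenter of $\mathbb{P}\in\mathcal{W}_2(\mathcal{W}_2(X))$ is a minimizer over $\mathcal{W}_2(X)$ of $\eta\mapsto\int d_W(\eta,\nu)^2\,d\mathbb{P}(\nu)$. A Borel measurable map $\pi:\mathcal{W}_2(X)\times\mathcal{W}_2(X)\to\mathcal{W}_2(X\times X)$, $(\mu,\nu)\mapsto\pi_\mu^\nu$, with $\pi_\mu^\nu\in\Gamma^o(\mu,\nu)$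 for all $\mu,\nu$ is fixed once and for all (such a map is known to exist for $X$ Polish; $X\times X$ carries the metric $d((x_1,x_2),(y_1,y_2))^2=d(x_1,y_1)^2+d(x_2,y_2)^2$). Restriction mappings. Given the decomposition $\mu=\lambda\mu^1+(1-\lambda)\mu^2$, there are nonnegative bounded measurable functions $g_1,g_2$ on $X$ with $\mu^i=g_i\,\mu$. For $\nu\in\mathcal{W}_2(X)$ put $\mathcal{R}^i(\nu)=\nu^i:=(p_2)_{\#}(g_i\,\pi_\mu^\nu)$, where $p_2(x,y)=y$ and $g_i\,\pi_\mu^\nu$ is the measure with density $(x,y)\mapsto g_i(x)$ with respect to $\pi_\mu^\nu$. The maps $\mathcal{R}^i$ are Borel measurable, so $\mathcal{R}^i_{\#}\mathbb{P}$ is well defined. *)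

(* Defs.v *)
From HB Require Import structures.
From mathcomp Require Import all_boot all_order all_algebra.
From mathcomp Require Import all_classical all_reals all_analysis.
From mathcomp Require Import measurable_realfun.
Set Implicit Arguments.
Unset Strict Implicit.
Unset Printing Implicit Defensive.
Import Order.TTheory GRing.Theory Num.Theory.
Import HBNNSimple.
Local Open Scope classical_set_scope.
Local Open Scope ring_scope.

(* [Complete] includes [Pointed], as do the measurable spaces of the library:
   the carrier is nonempty, which any probability measure on it forces. *)
#[short(type="completeMetricType")]
HB.structure Definition CompleteMetric (R : realType) :=
  { T of Complete T & Metric R T }.

Definition separable_space (T : topologicalType) : Prop :=
  exists2 D : set T, countable D & dense D.

Definition proper_metric (R : realType) (X : metricType R) : Prop :=
  forall (x : X) (r : R), compact [set y | mdist x y <= r].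

(* The Wasserstein construction is iterated (over X, X * X and W_2(X)), so it
   is written for a carrier T with an explicit distance d; the Borel sets are
   those generated by the sets that are open for d. *)
Definition dopen (R : realType) (T : Type) (d : T -> T -> R) : set (set T) :=
  [set U | forall x, U x ->
     exists2 e : R, 0 < e & forall y, d x y < e -> U y].

Lemma dopen_mdist (R : realType) (X : metricType R) :
  dopen (@mdist R X) = open.
Proof.
apply/seteqP; split => U.
  move=> dU; rewrite openE => x /dU [e e0 eU].
  apply/nbhs_ballP; exists e => //= y; rewrite ballEmdist; exact: eU.
rewrite openE => oU x /oU /nbhs_ballP[e /= e0 eU].
by exists e => // y xy; apply: eU; rewrite ballEmdist.
Qed.

Definition borel (R : realType) (T : pointedType) (d : T -> T -> R) :
    measurableType (dopen d).-sigma :=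
  Measurable.clone _ (g_sigma_algebraType (dopen d)) _.

Definition prod_dist (R : realType) (T1 T2 : Type)
    (d1 : T1 -> T1 -> R) (d2 : T2 -> T2 -> R) (x y : T1 * T2) : R :=
  Num.sqrt (d1 x.1 y.1 ^+ 2 + d2 x.2 y.2 ^+ 2).

Definition finite_second_moment (R : realType) (T : pointedType)
    (d : T -> T -> R) (m : set (borel d) -> \bar R) : Prop :=
  exists x0 : T, (\int[m]_(x in [set: borel d]) (d x0 x ^+ 2)%:E < +oo)%E.

(* As library measures are functions on all sets, two elements of [W2 d] may
   differ off the Borel sets; they are then at distance 0 and belong to the
   same Borel sets of [W2 d]. *)
Record W2 (R : realType) (T : pointedType) (d : T -> T -> R) := MkW2 {
  W2_prob :> probability (borel d) R ;
  W2_moment : finite_second_moment (d := d) W2_prob }.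

(* f need not be measurable. *)
Lemma ge0_integral_le_scale (R : realType) (dd : measure_display)
    (S : measurableType dd) (m1 m2 : {measure set S -> \bar R}) (M : R)
    (f : S -> \bar R) :
  (forall A, measurable A -> m1 A <= M%:E * m2 A)%E ->
  (forall x, 0 <= f x)%E -> 0 <= M ->
  (\int[m1]_x f x <= M%:E * \int[m2]_x f x)%E.
Proof.
move=> m12 f0 M0; rewrite !ge0_integralTE//.
apply: ge_ereal_sup => _ [h /= hf] <-.
apply: (le_trans (y := (M%:E * sintegral m2 h)%E)); last first.
  by apply: lee_wpmul2l; [rewrite lee_fin|apply: ereal_sup_ubound; exists h].
rewrite -!integralT_nnsfun -[M]/((NngNum M0)%:num) -ge0_integral_mscale//=.
- apply: ge0_le_measure_integral => //=.
  + by move=> x; rewrite lee_fin.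
  + by apply/measurable_EFinP; exact: measurable_funPT.
- by apply/measurable_EFinP; exact: measurable_funPT.
- by move=> x _; rewrite lee_fin.
Qed.

Section W2_pointed.
Context (R : realType) (T : pointedType) (d : T -> T -> R).

Lemma dirac_second_moment (x : T) :
  finite_second_moment (d := d) (dirac (x : borel d)).
Proof.
exists x; apply: le_lt_trans (ltry (d x x ^+ 2)).
rewrite ge0_integralTE; last by move=> y; rewrite lee_fin sqr_ge0.
apply: ge_ereal_sup => _ [h /= hf] <-.
rewrite -integralT_nnsfun integral_dirac ?diracT ?mul1e//.
exact/measurable_EFinP.
Qed.

HB.instance Definition _ := gen_eqMixin (W2 d).
HB.instance Definition _ := gen_choiceMixin (W2 d).
HB.instance Definition _ := isPointed.Build (W2 d)
  (MkW2 (W2_prob := dirac (point : borel d)) (dirac_second_moment point)).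
End W2_pointed.

Definition coupling (R : realType) (T : pointedType) (d : T -> T -> R)
    (mu nu : probability (borel d) R) :
    set (probability (borel (prod_dist d d)) R) :=
  [set pi | forall A : set (borel d), measurable A ->
     pushforward pi (fst : borel (prod_dist d d) -> borel d) A = mu A /\
     pushforward pi (snd : borel (prod_dist d d) -> borel d) A = nu A].

Definition transport_cost (R : realType) (T : pointedType) (d : T -> T -> R)
    (pi : probability (borel (prod_dist d d)) R) : \bar R :=
  \int[pi]_z (d z.1 z.2 ^+ 2)%:E.

Definition optimal_coupling (R : realType) (T : pointedType) (d : T -> T -> R)
    (mu nu : probability (borel d) R) :
    set (probability (borel (prod_dist d d)) R) :=
  [set pi | coupling mu nu pi /\
     forall pi', coupling mu nu pi' ->
       (transport_cost pi <= transport_cost pi')%E].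

(* For a separable metric d the infimum is finite; it is the minimum as soon as
   an optimal coupling exists. *)
Definition dW (R : realType) (T : pointedType) (d : T -> T -> R)
    (mu nu : W2 d) : R :=
  Num.sqrt (fine (ereal_inf (@transport_cost R T d @` coupling mu nu))).

Definition is_barycenter (R : realType) (T : pointedType) (d : T -> T -> R)
    (P : W2 (@dW R T d)) (b : W2 d) : Prop :=
  forall eta : W2 d,
    (\int[P]_nu (dW b nu ^+ 2)%:E <= \int[P]_nu (dW eta nu ^+ 2)%:E)%E.

Definition is_pushforward (R : realType) (dd1 dd2 : measure_display)
    (S1 : measurableType dd1) (S2 : measurableType dd2) (f : S1 -> S2)
    (P : probability S1 R) (Q : probability S2 R) : Prop :=
  measurable_fun [set: S1] f /\
  forall A, measurable A -> Q A = pushforward P f A.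

Definition mdensity (R : realType) (dd : measure_display)
    (S : measurableType dd) (m : set S -> \bar R) (g : S -> R) : set S -> \bar R :=
  fun A => (\int[m]_(x in A) (g x)%:E)%E.

Definition bounded_density (R : realType) (dd : measure_display)
    (S : measurableType dd) (mu m : probability S R) (g : S -> R) : Prop :=
  [/\ measurable_fun [set: S] g,
      forall x, 0 <= g x,
      exists M, forall x, g x <= M &
      forall A, measurable A -> m A = mdensity mu g A].

Section mdensity_measure.
Context (R : realType) (dd : measure_display) (S : measurableType dd).
Context (m : {measure set S -> \bar R}) (g : S -> R).
Hypotheses (mg : measurable_fun [set: S] g) (g0 : forall x, 0 <= g x).

Lemma mdensity0 : mdensity m g set0 = 0%E.
Proof. by rewrite /mdensity integral_set0. Qed.

Lemma mdensity_ge0 A : (0 <= mdensity m g A)%E.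
Proof. by apply: integral_ge0 => x _; rewrite lee_fin. Qed.

Lemma mdensity_sigma_additive : semi_sigma_additive (mdensity m g).
Proof.
apply: semi_sigma_additive_nng_induced; first exact/measurable_EFinP.
by move=> x; rewrite lee_fin.
Qed.

Lemma mdensity_le (M : R) (A : set S) : measurable A ->
  (forall x, g x <= M) -> (mdensity m g A <= M%:E * m A)%E.
Proof.
move=> mA gM; rewrite /mdensity -integral_cst//.
apply: ge0_le_integral => //=.
- by move=> x _; rewrite lee_fin.
- by apply: measurable_funTS; exact/measurable_EFinP.
- by move=> x _; rewrite lee_fin.
Qed.
End mdensity_measure.

Section restriction.
Context (R : realType) (T : pointedType) (d : T -> T -> R).

Lemma measurable_fst_borel :
  measurable_fun [set: borel (prod_dist d d)]
    (fst : borel (prod_dist d d) -> borel d).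
Proof.
apply: (@measurability _ _ (borel (prod_dist d d)) (borel d) _ _ (dopen d)) => //.
move=> _ [U dU <-]; rewrite setTI.
apply: sub_sigma_algebra => z /dU[e e0 eU]; exists e => // y zy.
apply: eU; apply: le_lt_trans zy; apply: le_trans (ler_norm _) _.
by rewrite -sqrtr_sqr /prod_dist ler_wsqrtr// lerDl sqr_ge0.
Qed.

Lemma measurable_snd_borel :
  measurable_fun [set: borel (prod_dist d d)]
    (snd : borel (prod_dist d d) -> borel d).
Proof.
apply: (@measurability _ _ (borel (prod_dist d d)) (borel d) _ _ (dopen d)) => //.
move=> _ [U dU <-]; rewrite setTI.
apply: sub_sigma_algebra => z /dU[e e0 eU]; exists e => // y zy.
apply: eU; apply: le_lt_trans zy; apply: le_trans (ler_norm _) _.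
by rewrite -sqrtr_sqr /prod_dist ler_wsqrtr// lerDr sqr_ge0.
Qed.

Lemma finite_second_moment_le (m1 m2 : {measure set (borel d) -> \bar R})
    (M : R) : 0 <= M ->
  (forall A, measurable A -> m1 A <= M%:E * m2 A)%E ->
  finite_second_moment (d := d) m2 -> finite_second_moment (d := d) m1.
Proof.
move=> M0 m12 [x0 x0oo]; exists x0.
apply: le_lt_trans (ge0_integral_le_scale m12 _ M0) _.
  by move=> x; rewrite lee_fin sqr_ge0.
by apply: lte_mul_pinfty => //; rewrite lee_fin.
Qed.

Lemma density_second_moment (mu : W2 d) (m : probability (borel d) R)
    (g : borel d -> R) :
  bounded_density mu m g -> finite_second_moment (d := d) m.
Proof.
move=> [mg g0 [M gM] mE].
apply: (finite_second_moment_le (M := M)) (W2_moment mu).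
  exact: le_trans (g0 point) (gM point).
by move=> A mA; rewrite [leLHS](mE A mA); exact: mdensity_le.
Qed.

Definition W2_density (mu : W2 d) (m : probability (borel d) R)
    (g : borel d -> R) (gm : bounded_density mu m g) : W2 d :=
  MkW2 (density_second_moment gm).

Section restricted.
Context (mu nu : W2 d) (m : probability (borel d) R) (g : borel d -> R).
Context (pi : probability (borel (prod_dist d d)) R).

(* The two hypotheses are only there for [restricted] to be recognized as a
   probability measure. *)
Definition restricted (_ : bounded_density mu m g) (_ : coupling mu nu pi) :
    set (borel d) -> \bar R :=
  pushforward (mdensity pi (fun z => g z.1))
    (snd : borel (prod_dist d d) -> borel d).

Hypotheses (gm : bounded_density mu m g) (cpi : coupling mu nu pi).

Let mg : measurable_fun [set: borel (prod_dist d d)] (fun z => g z.1).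
Proof. by case: gm => mg _ _ _; exact: measurableT_comp mg measurable_fst_borel. Qed.

Let g0 (z : borel (prod_dist d d)) : 0 <= g z.1.
Proof. by case: gm => _ + _ _; exact. Qed.

Let msnd (A : set (borel d)) : measurable A ->
  measurable ((snd : borel (prod_dist d d) -> borel d) @^-1` A).
Proof. by move=> mA; rewrite -[X in measurable X]setTI; exact: measurable_snd_borel. Qed.

Let restricted0 : restricted gm cpi set0 = 0%E.
Proof. by rewrite /restricted /pushforward preimage_set0 mdensity0. Qed.

Let restricted_ge0 A : (0 <= restricted gm cpi A)%E.
Proof. exact: mdensity_ge0. Qed.

Let restricted_sigma_additive : semi_sigma_additive (restricted gm cpi).
Proof.
move=> F mF tF mUF; rewrite /restricted /pushforward preimage_bigcup.
apply: mdensity_sigma_additive => //.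
- by move=> n; exact: msnd.
- apply/trivIsetP => /= i j _ _ ij; rewrite -preimage_setI.
  by move/trivIsetP : tF => /(_ _ _ _ _ ij) ->//; rewrite preimage_set0.
- by rewrite -preimage_bigcup; exact: msnd.
Qed.

HB.instance Definition _ := isMeasure.Build _ _ _ (restricted gm cpi)
  restricted0 restricted_ge0 restricted_sigma_additive.

Let restrictedT : restricted gm cpi [set: borel d] = 1%E.
Proof.
have [mg1 g1 _ mE] := gm.
rewrite /restricted /pushforward preimage_setT /mdensity.
pose p1 : borel (prod_dist d d) -> borel d := fst.
rewrite -(probability_setT m) mE// /mdensity.
transitivity (\int[pushforward pi p1]_x (g x)%:E)%E.
  rewrite ge0_integral_pushforward//.
  - exact: measurable_fst_borel.
  - exact/measurable_EFinP.
  - by move=> x _; rewrite lee_fin.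
apply: eq_measure_integral; first exact: measurable_fst_borel.
by move=> mp1 A mA _; case: (cpi mA).
Qed.

HB.instance Definition _ := Measure_isProbability.Build _ _ _
  (restricted gm cpi) restrictedT.

Lemma restricted_second_moment :
  finite_second_moment (d := d) (restricted gm cpi).
Proof.
have [_ _ [M gM] _] := gm.
apply: (finite_second_moment_le (M := M)) (W2_moment nu).
  exact: le_trans (g0 point) (gM point).
move=> A mA; rewrite [X in (_ <= _ * X)%E](esym (cpi mA).2).
by apply: mdensity_le => //; exact: msnd.
Qed.

Definition W2_restricted : W2 d := MkW2 restricted_second_moment.
End restricted.

Definition restriction (mu : W2 d) (m : probability (borel d) R)
    (g : borel d -> R) (pi : W2 d -> W2 (prod_dist d d))
    (gm : bounded_density mu m g) (cpi : forall nu : W2 d, coupling mu nu (pi nu)) :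
    W2 d -> W2 d :=
  fun nu => W2_restricted gm (cpi nu).
End restriction.

(* Main.v *)
Require Import Defs.
From HB Require Import structures.
From mathcomp Require Import all_boot all_order all_algebra.
From mathcomp Require Import all_classical all_reals all_analysis.
From mathcomp Require Import measurable_realfun.
From mathcomp Require Import ring lra.
Set Implicit Arguments.
Unset Strict Implicit.
Unset Printing Implicit Defensive.
Import Order.TTheory GRing.Theory Num.Theory.
Import HBNNSimple.
Local Open Scope classical_set_scope.
Local Open Scope ring_scope.

(** Let [nu^i] be the restriction of [nu]. Restricting the chosen optimal plan
    [pi_mu^nu] to the densities [g_i(x)] gives a coupling of [mu^i] and [nu^i],
    and the two restrictions recombine into [pi_mu^nu], so
      [lambda dW(mu^1, nu^1)^2 + (1 - lambda) dW(mu^2, nu^2)^2 <= dW(mu, nu)^2].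
    Conversely, if [eta = lambda eta^1 + (1 - lambda) mu^2], the corresponding
    mixture of plans couples [eta] and [nu], so
      [dW(eta, nu)^2 <= lambda dW(eta^1, nu^1)^2 + (1 - lambda) dW(mu^2, nu^2)^2].
    Integrating both against [P] and comparing [mu] with the competitor [eta]
    shows that [mu^1] does at least as well as [eta^1] for the image of [P],
    the finite term in [mu^2] being cancelled ([restriction_barycenter]).

    The remaining work is measurability, that of [nu |-> nu^i] and of
    [nu |-> dW(eta, nu)^2].

    For the second, the sets [dW(eta, .)^2 < r] are open. This follows from the
    weak triangle inequality
      [dW(mu, rho)^2 <= (1 + t) dW(mu, nu)^2 + 2 (1 + 1/t) dW(nu, rho)^2],
    for which no disintegration is needed: two plans are glued only
    approximately, as a sum of products over the cells of a countable partition
    of the middle space into small sets ([ex_glue], [dW_quasi_triangle]).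

    For the first, the map [gamma |-> (p_2)_# (g gamma)] is continuous, for the
    Wasserstein distances, on the plans with first marginal [mu]
    ([restricted_continuous]). Given a coupling of two such plans of small cost,
    written with points [((x, y), (x', y'))], the mass [min(g x, g x')] is sent
    from [y] to [y'] and the residual masses [(g x - g x')^+] at [y] and
    [(g x' - g x)^+] at [y'] are coupled arbitrarily. The residual mass is small
    because [(x, x')] is a coupling of [mu] with itself of small cost: the sets
    that such couplings rarely leave form a sigma-algebra containing the open
    sets ([rarely_exited_measurable]). Its cost is then small because
    [d(p, y)^2] is integrable. Composing with the measurable map
    [nu |-> pi_mu^nu] gives the measurability of the restriction mapping. *)

(** * Measures: densities, images, and gluing along countable partitions *)

Section measures.
Context (R : realType).

Section prob_of.
Context d (S : measurableType d) (m : {measure set S -> \bar R}).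
(** The measure [m] itself; the proof that its total mass is 1 is an argument
    so that it can be declared a probability measure. *)
Definition prob_of (_ : m setT = 1%E) : set S -> \bar R := m.
Hypothesis m1 : m setT = 1%E.
HB.instance Definition _ := Measure.on (prob_of m1).
HB.instance Definition _ := Measure_isProbability.Build _ _ _ (prob_of m1) m1.
End prob_of.

Lemma ex_probability d (S : measurableType d) (m : {measure set S -> \bar R}) :
  m setT = 1%E -> exists P : probability S R, P = m :> (set S -> \bar R).
Proof. by move=> m1; exists (prob_of m1). Qed.

Lemma ge0_integral_density d (S : measurableType d)
    (m m' : {measure set S -> \bar R}) (f : S -> R) :
  measurable_fun setT f -> (forall x, 0 <= f x) ->
  (forall A, measurable A -> m' A = \int[m]_(x in A) (f x)%:E)%E ->
  forall k : S -> \bar R, measurable_fun setT k -> (forall x, 0 <= k x)%E ->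
  (\int[m']_x k x = \int[m]_x (k x * (f x)%:E))%E.
Proof.
move=> mf f0 mE k mk k0.
have mF : measurable_fun setT (fun x => (f x)%:E) by exact/measurable_EFinP.
pose k_ := nnsfun_approx measurableT mk.
have simple (h : {nnsfun S >-> R}) :
    (\int[m']_x (h x)%:E = \int[m]_x ((h x)%:E * (f x)%:E))%E.
  rewrite integralT_nnsfun sintegralE.
  transitivity (\int[m]_x \sum_(r \in range h)
      (r%:E * ((f x)%:E * (\1_(h @^-1` [set r]) x)%:E)))%E; last first.
    apply: eq_integral => x _; rewrite fimfunE -fsumEFin// ge0_mule_fsuml; last first.
      by move=> r; rewrite nnfun_muleindic_ge0.
    by apply: eq_fsbigr => r _; rewrite EFinM -muleA [((f x)%:E * _)%E]muleC.
  rewrite ge0_integral_fsum//; last 2 first.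
  - move=> r; apply: emeasurable_funM => //; apply: emeasurable_funM => //.
    exact/measurable_EFinP/measurable_indic.
  - move=> r x _; rewrite muleCA mule_ge0 ?lee_fin//.
    exact: nnfun_muleindic_ge0.
  apply: eq_fsbigr => r /[!inE] -[t _ <-].
  rewrite ge0_integralZl//; last 3 first.
  - by apply: emeasurable_funM => //; exact/measurable_EFinP/measurable_indic.
  - by move=> x _; rewrite mule_ge0// lee_fin.
  - by rewrite lee_fin.
  congr (_ * _)%E; rewrite mE// integral_mkcond; apply: eq_integral => x _.
  by rewrite patchE indicE; case: ifP => _; rewrite ?mule1 ?mule0.
have nd_k a b : (a <= b)%N -> forall x, ((k_ a x)%:E <= (k_ b x)%:E)%E.
  by move=> ab x; rewrite lee_fin; exact/lefP/nd_nnsfun_approx.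
transitivity (limn (fun n => \int[m']_x (k_ n x)%:E)%E).
  rewrite -monotone_convergence//=.
  - apply: eq_integral => x _; apply/esym/cvg_lim => //=.
    exact: cvg_nnsfun_approx.
  - by move=> n; exact/measurable_EFinP.
  - by move=> n x _; rewrite lee_fin.
  - by move=> x _ a b ab; exact: nd_k.
transitivity (limn (fun n => \int[m]_x ((k_ n x)%:E * (f x)%:E))%E).
  by congr (limn _); apply/funext => n; exact: simple.
rewrite -monotone_convergence//=.
- apply: eq_integral => x _; apply/cvg_lim => //=.
  apply: cvgeMr => //; exact: cvg_nnsfun_approx.
- by move=> n; apply: emeasurable_funM => //; exact/measurable_EFinP.
- by move=> n x _; rewrite mule_ge0 ?lee_fin.
- by move=> x _ a b ab; rewrite lee_wpmul2r ?lee_fin//; exact: nd_k.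
Qed.

Section density_of.
Context d (S : measurableType d) (m : {measure set S -> \bar R}) (f : S -> R).
(** The measure with density [f] with respect to [m]; the hypotheses on [f] are
    arguments so that it can be declared a measure. *)
Definition density_of (_ : measurable_fun setT f) (_ : forall x, 0 <= f x) :
  set S -> \bar R := mdensity m f.
Hypotheses (mf : measurable_fun setT f) (f0 : forall x, 0 <= f x).
HB.instance Definition _ := isMeasure.Build _ _ _ (density_of mf f0)
  (mdensity0 m f) (mdensity_ge0 m f0) (mdensity_sigma_additive mf f0).
End density_of.

Lemma ex_density d (S : measurableType d) (m : {measure set S -> \bar R})
    (f : S -> R) :
  measurable_fun setT f -> (forall x, 0 <= f x) ->
  exists m' : {measure set S -> \bar R}, m' = mdensity m f :> (set S -> \bar R).
Proof. by move=> mf f0; exists (density_of m mf f0). Qed.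

Lemma ex_pushforward d1 d2 (S1 : measurableType d1) (S2 : measurableType d2)
    (m : {measure set S1 -> \bar R}) (f : S1 -> S2) :
  measurable_fun setT f ->
  exists2 m' : {measure set S2 -> \bar R},
    forall A, m' A = m (f @^-1` A) &
    forall k : S2 -> \bar R, measurable_fun setT k -> (forall x, 0 <= k x)%E ->
    (\int[m']_x k x = \int[m]_x k (f x))%E.
Proof.
move=> mf; unshelve eexists (pushforward m f); [exact: mf|by []|].
by move=> k mk k0; rewrite ge0_integral_pushforward.
Qed.

Lemma ex_scale d (S : measurableType d) (m : {measure set S -> \bar R}) (r : R) :
  0 <= r -> exists2 m' : {measure set S -> \bar R},
    forall A, m' A = (r%:E * m A)%E &
    forall k : S -> \bar R, measurable_fun setT k -> (forall x, 0 <= k x)%E ->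
    (\int[m']_x k x = r%:E * \int[m]_x k x)%E.
Proof.
move=> r0; exists (mscale (NngNum r0) m) => // k mk k0.
by rewrite ge0_integral_mscale.
Qed.

Lemma ex_add d (S : measurableType d) (m1 m2 : {measure set S -> \bar R}) :
  exists2 m' : {measure set S -> \bar R},
    forall A, m' A = (m1 A + m2 A)%E &
    forall k : S -> \bar R, measurable_fun setT k -> (forall x, 0 <= k x)%E ->
    (\int[m']_x k x = \int[m1]_x k x + \int[m2]_x k x)%E.
Proof.
exists (measure_add m1 m2) => [A|k mk k0]; first exact: measure_addE.
by rewrite ge0_integral_measure_add.
Qed.

Lemma eq_integral_measure d (S : measurableType d)
    (m1 m2 : {measure set S -> \bar R}) :
  (forall A, measurable A -> m1 A = m2 A) ->
  forall k : S -> \bar R, (\int[m1]_x k x = \int[m2]_x k x)%E.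
Proof. by move=> m12 k; apply: eq_measure_integral => A mA _; exact: m12. Qed.

(** Gluing of [m1] and [m2] along countably many labels: if the labels [c1] and
    [c2] have the same law, there is a coupling under which they agree almost
    surely. With constant labels this is a coupling of two arbitrary finite
    measures of equal mass. *)
Lemma ex_glue d1 d2 (S1 : measurableType d1) (S2 : measurableType d2)
    (m1 : {finite_measure set S1 -> \bar R})
    (m2 : {finite_measure set S2 -> \bar R})
    (c1 : S1 -> nat) (c2 : S2 -> nat) :
  measurable_fun setT c1 -> measurable_fun setT c2 ->
  (forall k, m1 (c1 @^-1` [set k]) = m2 (c2 @^-1` [set k])) ->
  exists m : {measure set (S1 * S2) -> \bar R},
  [/\ forall A, measurable A -> m (A `*` setT) = m1 A,
      forall B, measurable B -> m (setT `*` B) = m2 B &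
      m [set z | c1 z.1 != c2 z.2] = 0%E].
Proof.
move=> mc1 mc2 c12.
have mC1 k : measurable (c1 @^-1` [set k]) by rewrite -[X in measurable X]setTI;
  exact: mc1.
have mC2 k : measurable (c2 @^-1` [set k]) by rewrite -[X in measurable X]setTI;
  exact: mc2.
(* Products over the cells of equal label, normalized by the mass of the cell.
   If that mass is 0 its inverse is 0, and the cell carries no mass on either
   side. *)
have w0 k : 0 <= (fine (m2 (c2 @^-1` [set k])))^-1 by rewrite invr_ge0 fine_ge0.
pose n k : {measure set (S1 * S2) -> \bar R} :=
  (mrestr m1 (mC1 k) \x mrestr m2 (mC2 k))%E.
pose s k : {measure set (S1 * S2) -> \bar R} := mscale (NngNum (w0 k)) (n k).
have nE k A B : measurable A -> measurable B ->
    n k (A `*` B) = (m1 (A `&` c1 @^-1` [set k]) * m2 (B `&` c2 @^-1` [set k]))%E.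
  by move=> mA mB; exact: product_measure1E.
have sE k A : s k A = (((fine (m2 (c2 @^-1` [set k])))^-1)%:E * n k A)%E by [].
have sum1 A : measurable A -> (\sum_(0 <= k <oo) m1 (A `&` c1 @^-1` [set k]))%E = m1 A.
  move=> mA; rewrite -measure_semi_bigcup//.
  - by congr (m1 _); rewrite -setI_bigcupr; apply/seteqP; split => [x []//|x Ax];
    split => //; exists (c1 x).
  - by move=> i; exact: measurableI.
  - by apply/trivIsetP => i j _ _ ij; apply/seteqP; split =>
    // x [[_ /= ->] [_ /eqP]]; rewrite (negbTE ij).
  - by apply: bigcup_measurable => i _; exact: measurableI.
have sum2 A : measurable A -> (\sum_(0 <= k <oo) m2 (A `&` c2 @^-1` [set k]))%E = m2 A.
  move=> mA; rewrite -measure_semi_bigcup//.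
  - by congr (m2 _); rewrite -setI_bigcupr; apply/seteqP; split => [x []//|x Ax];
    split => //; exists (c2 x).
  - by move=> i; exact: measurableI.
  - by apply/trivIsetP => i j _ _ ij; apply/seteqP; split =>
    // x [[_ /= ->] [_ /eqP]]; rewrite (negbTE ij).
  - by apply: bigcup_measurable => i _; exact: measurableI.
exists (mseries s 0); split.
- move=> A mA; rewrite -(sum1 _ mA); apply: eq_eseriesr => k _.
  rewrite sE nE// setTI.
  have /fineK <- : m2 (c2 @^-1` [set k]) \is a fin_num by exact: fin_num_measure.
  have [p0|p0] := eqVneq (fine (m2 (c2 @^-1` [set k]))) 0.
    suff -> : m1 (A `&` c1 @^-1` [set k]) = 0%E by rewrite mul0e mule0.
    apply/eqP; rewrite -measure_le0.
    apply: (@le_trans _ _ (m1 (c1 @^-1` [set k]))).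
      by apply: le_measure; [rewrite inE;
        exact: measurableI|rewrite inE|exact: subIsetr].
    by rewrite c12 -[X in (X <= _)%E]fineK ?p0// fin_num_measure.
  by rewrite muleCA -EFinM mulVf// mule1.
- move=> A mA; rewrite -(sum2 _ mA); apply: eq_eseriesr => k _.
  rewrite sE nE// setTI c12.
  have [p0|p0] := eqVneq (fine (m2 (c2 @^-1` [set k]))) 0.
    suff -> : m2 (A `&` c2 @^-1` [set k]) = 0%E by rewrite !mule0.
    apply/eqP; rewrite -measure_le0.
    apply: (@le_trans _ _ (m2 (c2 @^-1` [set k]))).
      by apply: le_measure; [rewrite inE;
        exact: measurableI|rewrite inE|exact: subIsetr].
    by rewrite -[X in (X <= _)%E]fineK ?p0// fin_num_measure.
  by rewrite -[X in (_ * (X * _))%E]fineK ?fin_num_measure// muleA -EFinM mulVf// mul1e.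
- rewrite /mseries; apply: eseries0 => k _ _.
  suff n0 : n k [set z | c1 z.1 != c2 z.2] = 0%E by rewrite sE n0 mule0.
  have mD : measurable [set z : S1 * S2 | c1 z.1 != c2 z.2].
    rewrite (_ : [set _ | _] = ~` \bigcup_k (c1 @^-1` [set k] `*` c2 @^-1` [set k])).
      by apply: measurableC; apply: bigcup_measurable => j _; exact: measurableX.
    apply/seteqP; split => [z /= /eqP c12z [j _ [/= c1j c2j]]|z /= h].
      by apply: c12z; rewrite c1j c2j.
    by apply/eqP => e; apply: h; exists (c1 z.1).
  apply/eqP; rewrite -measure_le0.
  pose D := ((~` (c1 @^-1` [set k])) `*` [set: S2]) `|` ([set: S1] `*` ~` (c2 @^-1`
    [set k])).
  have mD1 : measurable ((~` (c1 @^-1` [set k])) `*` [set: S2]).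
    by apply: measurableX => //; exact: measurableC.
  have mD2 : measurable ([set: S1] `*` ~` (c2 @^-1` [set k])).
    by apply: measurableX => //; exact: measurableC.
  apply: (@le_trans _ _ (n k D)).
    apply: le_measure; rewrite ?inE//; first exact: measurableU.
    move=> z /= /eqP h; have [c1k|] := eqVneq (c1 z.1) k.
      by right; split => //= c2k; apply: h; rewrite c1k c2k.
    by move=> /eqP; left.
  apply: (@le_trans _ _ (n k ((~` (c1 @^-1` [set k])) `*` setT) +
                         n k (setT `*` ~` (c2 @^-1` [set k])))%E).
    exact: measureU2.
  rewrite !nE//; [|exact: measurableC|exact: measurableC].
  by rewrite !setICl !measure0 mule0 mul0e adde0.
Qed.
End measures.

(** * Separable pseudometrics and their Borel sets *)

(** The axioms of a separable pseudometric on a plain distance function, a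
    countable dense set being given by an enumeration. *)
Record separable_pseudometric (R : realType) (T : Type) (d : T -> T -> R) : Prop :=
  SeparablePseudometric {
  spm_refl : forall x, d x x = 0 ;
  spm_sym : forall x y, d x y = d y x ;
  spm_triangle : forall y x z, d x z <= d x y + d y z ;
  spm_dense : exists q : nat -> T, forall x e, 0 < e -> exists n, d x (q n) < e }.

Section measurability.
Context (R : realType).

Lemma measurable_fun_ltP disp (S : measurableType disp) (f : S -> R) :
  (forall r, measurable [set x | f x < r]) -> measurable_fun setT f.
Proof.
move=> mf mD; apply: (measurability _ (RGenInftyO.measurableE R)) => // _ [_ [r ->] <-].
by rewrite setTI; exact: mf.
Qed.

Lemma measurable_fun_natP disp (S : measurableType disp) (f : S -> nat) :
  (forall k, measurable (f @^-1` [set k])) -> measurable_fun setT f.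
Proof.
move=> mf _ B _; rewrite setTI.
rewrite (_ : _ @^-1` _ = \bigcup_(k in B) (f @^-1` [set k])).
  exact: bigcup_measurable.
by apply/seteqP; split => [x Bx|x [k Bk /= fx]]; [exists (f x)|rewrite /= fx].
Qed.

Lemma measurable_fun_borel disp (S : measurableType disp) (T : pointedType)
    (d : T -> T -> R) (f : S -> borel d) :
  (forall U, dopen d U -> measurable (f @^-1` U)) -> measurable_fun setT f.
Proof.
move=> mf; apply: (@measurability _ _ S (borel d) _ _ (dopen d)) => //.
by move=> _ [U dU <-]; rewrite setTI; exact: mf.
Qed.

Lemma measurable_dopen (T : pointedType) (d : T -> T -> R) (U : set T) :
  dopen d U -> measurable (U : set (borel d)).
Proof. exact: sub_sigma_algebra. Qed.
End measurability.

Section pseudometric.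
Context (R : realType) (T : pointedType) (d : T -> T -> R).
Hypothesis dP : separable_pseudometric d.

Lemma spm_ge0 x y : 0 <= d x y.
Proof.
have := spm_triangle dP y x x; rewrite (spm_refl dP) (spm_sym dP y x) -mulr2n.
by rewrite pmulrn_lge0.
Qed.

Lemma dopen_ball x r : dopen d [set y | d x y < r].
Proof.
move=> y /= xy; exists (r - d x y); first by rewrite subr_gt0.
move=> z yz; apply: le_lt_trans (spm_triangle dP y x z) _.
by rewrite -ltrBrDl.
Qed.

(** Separability makes every open set of the product a countable union of
    products of balls, so the Borel sets of the product distance are no more
    than those of the product sigma-algebra. *)
Lemma measurable_pair_borel disp (S : measurableType disp) (f1 f2 : S -> borel d) :
  measurable_fun setT f1 -> measurable_fun setT f2 ->
  measurable_fun setT (fun s => (f1 s, f2 s) : borel (prod_dist d d)).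
Proof.
move=> mf1 mf2; apply: measurable_fun_borel => U dU.
have [q qP] := spm_dense dP.
pose B i n : set T := [set y | d (q i) y < n.+1%:R^-1].
have mB (f : S -> borel d) (mf : measurable_fun setT f) i n : measurable (f @^-1` B i
  n).
  rewrite -[X in measurable X]setTI; apply: mf => //.
  by apply: measurable_dopen; exact: dopen_ball.
pose W i j n := B i n `*` B j n `<=` U.
rewrite (_ : _ @^-1` _ = \bigcup_n \bigcup_i \bigcup_(j in [set j | W i j n])
    (f1 @^-1` B i n `&` f2 @^-1` B j n)).
  apply: bigcupT_measurable => n; apply: bigcupT_measurable => i.
  by apply: bigcup_measurable => j _; apply: measurableI; exact: mB.
apply/seteqP; split => [s Us|s [n _ [i _ [j Wij [h1 h2]]]]]; last by apply: Wij.
have [e e0 eU] := dU _ Us.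
have [n nE] : exists n : nat, n.+1%:R^-1 < e / 4 :> R.
  have e40 : 0 < e / 4 by rewrite divr_gt0.
  exists (Num.truncn (e / 4)^-1); rewrite invf_plt ?posrE//.
  by rewrite truncnS_gt.
have n0 : 0 < n.+1%:R^-1 :> R by [].
have [i qi] := qP (f1 s) _ n0; have [j qj] := qP (f2 s) _ n0.
exists n => //; exists i => //; exists j; last first.
  by split; rewrite /= /B /= (spm_sym dP).
move=> [y1 y2] [/= B1 B2]; apply: eU; rewrite /prod_dist/=.
have h1 := spm_triangle dP (q i) (f1 s) y1.
have h2 := spm_triangle dP (q j) (f2 s) y2.
have p1 := spm_ge0 (f1 s) y1; have p2 := spm_ge0 (f2 s) y2.
rewrite /B/= in B1 B2.
apply: (@le_lt_trans _ _ (d (f1 s) y1 + d (f2 s) y2)).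
  rewrite -[leRHS]ger0_norm ?addr_ge0// -sqrtr_sqr ler_wsqrtr//.
  by rewrite sqrrD lerD2r lerDl mulrn_wge0// mulr_ge0.
move: (n.+1%:R^-1) nE qi qj B1 B2 => t *; lra.
Qed.

Lemma prod_dist_ge (x y : T * T) : d x.1 y.1 <= prod_dist d d x y /\ d x.2 y.2 <=
  prod_dist d d x y.
Proof.
by split; apply: le_trans (ler_norm _) _;
  rewrite -sqrtr_sqr ler_wsqrtr// ?lerDl ?lerDr sqr_ge0.
Qed.

Lemma measurable_dist : measurable_fun setT (fun z : borel (prod_dist d d) =>
  d z.1 z.2).
Proof.
apply: measurable_fun_ltP => r; apply: measurable_dopen => -[x y] /= xyr.
exists ((r - d x y) / 2); first by rewrite divr_gt0// subr_gt0.
move=> [x' y'] /= h.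
have [/= h1 h2] := prod_dist_ge (x, y) (x', y').
have h3 := spm_triangle dP x x' y'; have h4 := spm_triangle dP y x y'.
rewrite (spm_sym dP x' x) in h3; lra.
Qed.

Lemma separable_pseudometric_prod : separable_pseudometric (prod_dist d d).
Proof.
split.
- by move=> [x y]; rewrite /prod_dist/= !(spm_refl dP) expr0n/= addr0 sqrtr0.
- by move=> x y; rewrite /prod_dist (spm_sym dP x.1) (spm_sym dP x.2).
- move=> [y y'] [x x'] [z z']; rewrite /prod_dist/=.
  set A := d x z; set B := d x' z'; set a := d x y; set b := d x' y'.
  set a' := d y z; set b' := d y' z'.
  have A0 : 0 <= A by exact: spm_ge0.
  have B0 : 0 <= B by exact: spm_ge0.
  have a0 : 0 <= a by exact: spm_ge0.
  have b0 : 0 <= b by exact: spm_ge0.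
  have a'0 : 0 <= a' by exact: spm_ge0.
  have b'0 : 0 <= b' by exact: spm_ge0.
  have hA : A <= a + a' by exact: spm_triangle.
  have hB : B <= b + b' by exact: spm_triangle.
  set s := Num.sqrt (a ^+ 2 + _); set s' := Num.sqrt (a' ^+ 2 + _).
  have s0 : 0 <= s by rewrite sqrtr_ge0.
  have s'0 : 0 <= s' by rewrite sqrtr_ge0.
  rewrite -[leRHS]ger0_norm ?addr_ge0// -sqrtr_sqr ler_wsqrtr//.
  have sE : s ^+ 2 = a ^+ 2 + b ^+ 2 by rewrite sqr_sqrtr// addr_ge0 ?sqr_ge0.
  have s'E : s' ^+ 2 = a' ^+ 2 + b' ^+ 2 by rewrite sqr_sqrtr// addr_ge0 ?sqr_ge0.
  have CS : a * a' + b * b' <= s * s'.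
    rewrite -(@ler_pXn2r _ 2)// ?nnegrE ?addr_ge0 ?mulr_ge0//.
    rewrite exprMn sE s'E -subr_ge0.
    rewrite (_ : _ - _ = (a * b' - b * a') ^+ 2); first exact: sqr_ge0.
    by ring.
  have hA2 : A ^+ 2 <= (a + a') ^+ 2 by rewrite ler_pXn2r// ?nnegrE ?addr_ge0.
  have hB2 : B ^+ 2 <= (b + b') ^+ 2 by rewrite ler_pXn2r// ?nnegrE ?addr_ge0.
  apply: le_trans (lerD hA2 hB2) _.
  by rewrite (sqrrD s) sE s'E !sqrrD; lra.
- have [q qP] := spm_dense dP.
  exists (fun n => if unpickle n is Some (i, j) then (q i, q j) else point).
  move=> [x y] e e0; have e20 : 0 < e / 2 by rewrite divr_gt0.
  have [i qi] := qP x _ e20; have [j qj] := qP y _ e20.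
  exists (pickle (i, j)); rewrite pickleK /prod_dist/=.
  have p1 := spm_ge0 x (q i); have p2 := spm_ge0 y (q j).
  apply: (@le_lt_trans _ _ (d x (q i) + d y (q j))); last by lra.
  rewrite -[leRHS]ger0_norm ?addr_ge0// -sqrtr_sqr ler_wsqrtr//.
  by rewrite sqrrD lerD2r lerDl mulrn_wge0// mulr_ge0.
Qed.

(** A countable Borel partition into sets of diameter less than [e], given by
    the label of each point. *)
Lemma ex_cells (e : R) : 0 < e -> exists2 c : borel d -> nat,
  measurable_fun setT c & forall x y, c x = c y -> d x y < e.
Proof.
move=> e0; have [q qP] := spm_dense dP.
have e20 : 0 < e / 2 by rewrite divr_gt0.
(* The label of [x] is the first dense point within distance [e / 2]. *)
pose c x := ex_minn (qP x _ e20).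
exists c; last first.
  move=> x y; rewrite /c; case: ex_minnP => i xi _; case: ex_minnP => j yj _ ij.
  have := spm_triangle dP (q i) x y; rewrite (spm_sym dP (q i)) -ij in yj *.
  lra.
apply: measurable_fun_natP => k.
pose B i : set (borel d) := [set y | d (q i) y < e / 2].
have mB i : measurable (B i) by apply: measurable_dopen; exact: dopen_ball.
rewrite (_ : _ @^-1` _ = B k `\` \bigcup_(j in [set j | (j < k)%N]) B j).
  by apply: measurableD => //; exact: bigcup_measurable.
apply/seteqP; split => x /=.
  rewrite /c; case: ex_minnP => i xi mini <-; split; first by rewrite /B/= (spm_sym dP).
  by move=> [j /= ji]; rewrite /B/= (spm_sym dP) => /mini; rewrite leqNgt ji.
move=> [Bk nB]; rewrite /c; case: ex_minnP => i xi mini; apply/eqP; rewrite eqn_leq.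
rewrite mini ?(spm_sym dP x)//= leqNgt; apply/negP => ik; apply: nB; exists i => //.
by rewrite /B/= (spm_sym dP).
Qed.
End pseudometric.

Lemma separable_pseudometric_mdist (R : realType) (X : completeMetricType R) :
  separable_space X -> separable_pseudometric (@mdist R X).
Proof.
move=> [D cD dD]; split.
- exact: mdistxx.
- by move=> x y; exact: metric_sym.
- by move=> y x z; exact: metric_triangle.
- have near x e : 0 < e -> exists2 y, D y & mdist x y < e.
    move=> e0; pose U := [set y | mdist x y < e].
    have oU : open U.
      rewrite -dopen_mdist => y /= xy; exists (e - mdist x y); first
        by rewrite subr_gt0.
      move=> z yz; apply: le_lt_trans (metric_triangle x y z) _.
      by rewrite -ltrBrDl.
    have U0 : U !=set0 by exists x; rewrite /U/= mdistxx.
    by have [y [xy Dy]] := dD _ U0 oU; exists y.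
  have /countable_injP[f fI] := cD.
  exists (fun n => xget point [set y | D y /\ f y = n]) => x e /(near x)[y Dy xy].
  exists (f y); case: xgetP => [z _ [Dz fzy]|/(_ y)/=/not_andP[]//].
  by rewrite (fI z y)// inE.
Qed.

(** * Couplings and the Wasserstein distance *)

Section bounds.
Context (R : realType) (disp : measure_display) (S : measurableType disp).
Implicit Types (m : {measure set S -> \bar R}) (f g h : S -> R).

Lemma measurable_linear f g c1 c2 :
  measurable_fun setT f -> measurable_fun setT g ->
  measurable_fun setT (fun x => c1 * f x + c2 * g x).
Proof. by move=> mf mg; apply: measurable_funD; apply: measurable_funM. Qed.

Lemma integral_linear m f g c1 c2 :
  measurable_fun setT f -> measurable_fun setT g ->
  (forall x, 0 <= f x) -> (forall x, 0 <= g x) -> 0 <= c1 -> 0 <= c2 ->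
  (\int[m]_x (c1 * f x + c2 * g x)%:E =
   c1%:E * \int[m]_x (f x)%:E + c2%:E * \int[m]_x (g x)%:E)%E.
Proof.
move=> mf mg f0 g0 c10 c20.
have mF : measurable_fun setT (fun x => (f x)%:E) by exact/measurable_EFinP.
have mG : measurable_fun setT (fun x => (g x)%:E) by exact/measurable_EFinP.
under eq_integral do rewrite EFinD !EFinM.
rewrite ge0_integralD//.
- by rewrite !ge0_integralZl_EFin// => x _; rewrite lee_fin.
- by move=> x _; rewrite mule_ge0 ?lee_fin.
- by apply: emeasurable_funM.
- by move=> x _; rewrite mule_ge0 ?lee_fin.
- by apply: emeasurable_funM.
Qed.

(** Integration of an almost everywhere bound [h <= c1 f + c2 g + c3] against a
    measure of mass at most 1. *)
Lemma integral_le_linear m f g h c1 c2 c3 (a b : R) :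
  (m setT <= 1)%E ->
  measurable_fun setT f -> measurable_fun setT g -> measurable_fun setT h ->
  (forall x, 0 <= f x) -> (forall x, 0 <= g x) -> (forall x, 0 <= h x) ->
  0 <= c1 -> 0 <= c2 -> 0 <= c3 ->
  (exists2 N, (measurable N /\ m N = 0%E) &
    forall x, ~ N x -> h x <= c1 * f x + c2 * g x + c3) ->
  (\int[m]_x (f x)%:E <= a%:E)%E -> (\int[m]_x (g x)%:E <= b%:E)%E ->
  (\int[m]_x (h x)%:E <= (c1 * a + c2 * b + c3)%:E)%E.
Proof.
move=> m1 mf mg mh f0 g0 h0 c10 c20 c30 [N [mN N0] hN] fa gb.
have mfg : measurable_fun setT (fun x => c1 * f x + c2 * g x).
  exact: measurable_linear.
apply: (@le_trans _ _ (\int[m]_x ((c1 * f x + c2 * g x) + c3)%:E)%E).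
  apply: ae_ge0_le_integral => //.
  - by move=> x _; rewrite lee_fin.
  - exact/measurable_EFinP.
  - by move=> x _; rewrite lee_fin !addr_ge0// mulr_ge0.
  - by apply/measurable_EFinP; exact: measurable_funD.
  - exists N; split => // x /= hx; apply: contrapT => Nx; apply: hx => _.
    by rewrite lee_fin hN.
under eq_integral do rewrite EFinD.
rewrite ge0_integralD//.
- rewrite integral_linear// integral_cst//.
  rewrite !EFinD !EFinM; apply: leeD; first by apply: leeD; apply: lee_wpmul2l.
  by rewrite -[leRHS]mule1; apply: lee_wpmul2l.
- by move=> x _; rewrite lee_fin addr_ge0// mulr_ge0.
- exact/measurable_EFinP.
Qed.
End bounds.

Section wasserstein.
Context (R : realType) (T : pointedType) (d : T -> T -> R).
Hypothesis dP : separable_pseudometric d.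
Implicit Types (mu nu rho : probability (borel d) R) (m : W2 d).

Lemma measurable_sqdist :
  measurable_fun setT (fun z : borel (prod_dist d d) => d z.1 z.2 ^+ 2).
Proof. by apply: measurable_funX; exact: measurable_dist. Qed.

Lemma measurable_sqdistl p : measurable_fun setT (fun y : borel d => d p y ^+ 2).
Proof.
apply: measurable_funX; apply: measurable_fun_ltP => r.
by apply: measurable_dopen; exact: dopen_ball.
Qed.

Lemma sqdist_le (t : R) x y z : 0 < t ->
  d x z ^+ 2 <= (1 + t) * d x y ^+ 2 + (1 + t^-1) * d y z ^+ 2.
Proof.
move=> t0; have h := spm_triangle dP y x z.
have a0 := spm_ge0 dP x y; have b0 := spm_ge0 dP y z; have c0 := spm_ge0 dP x z.
apply: (@le_trans _ _ ((d x y + d y z) ^+ 2)); first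
  by rewrite ler_pXn2r ?nnegrE ?addr_ge0.
rewrite -subr_ge0 (_ : _ - _ = t^-1 * (t * d x y - d y z) ^+ 2).
  by rewrite mulr_ge0 ?sqr_ge0// invr_ge0 ltW.
by field; rewrite gt_eqF.
Qed.

Lemma sqdist_le2 x y z : d x z ^+ 2 <= 2 * d x y ^+ 2 + 2 * d y z ^+ 2.
Proof. by have := @sqdist_le 1 x y z ltr01; rewrite invr1. Qed.

Lemma W2_moment_lt m p : (\int[m]_x (d p x ^+ 2)%:E < +oo)%E.
Proof.
have [x0 x0oo] := W2_moment m.
have [a aE] : exists a, (\int[m]_x (d x0 x ^+ 2)%:E = a%:E)%E.
  exists (fine (\int[m]_x (d x0 x ^+ 2)%:E)); rewrite fineK// ge0_fin_numE//.
  by apply: integral_ge0 => x _; rewrite lee_fin sqr_ge0.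
apply: le_lt_trans (ltry (2 * a + 0 * a + 2 * d p x0 ^+ 2)).
apply: (@integral_le_linear _ _ _ m (fun x => d x0 x ^+ 2) (fun x => d x0 x ^+ 2)) =>
  //.
- exact: sprobability_setT.
- exact: measurable_sqdistl.
- exact: measurable_sqdistl.
- exact: measurable_sqdistl.
- by move=> x; exact: sqr_ge0.
- by move=> x; exact: sqr_ge0.
- by move=> x; exact: sqr_ge0.
- by rewrite mulr_ge0 ?sqr_ge0.
- by exists set0 => // x _; rewrite mul0r addr0 addrC; exact: sqdist_le2.
- by rewrite aE.
- by rewrite aE.
Qed.

Lemma coupling_integral_fst mu nu pi (k : borel d -> \bar R) :
  coupling mu nu pi -> measurable_fun setT k -> (forall x, 0 <= k x)%E ->
  (\int[pi]_z k z.1 = \int[mu]_x k x)%E.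
Proof.
move=> cpi mk k0.
have [m mE mi] := ex_pushforward pi (@measurable_fst_borel R T d).
rewrite -mi//; apply: eq_integral_measure => A mA; rewrite [LHS]mE.
by case: (cpi _ mA).
Qed.

Lemma coupling_integral_snd mu nu pi (k : borel d -> \bar R) :
  coupling mu nu pi -> measurable_fun setT k -> (forall x, 0 <= k x)%E ->
  (\int[pi]_z k z.2 = \int[nu]_x k x)%E.
Proof.
move=> cpi mk k0.
have [m mE mi] := ex_pushforward pi (@measurable_snd_borel R T d).
rewrite -mi//; apply: eq_integral_measure => A mA; rewrite [LHS]mE.
by case: (cpi _ mA).
Qed.

(** The joint image of a measure under [f1] and [f2] couples its two image
    measures. *)
Lemma ex_coupling_pushforward disp (S : measurableType disp)
    (m : {measure set S -> \bar R}) (f1 f2 : S -> borel d) mu nu :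
  measurable_fun setT f1 -> measurable_fun setT f2 ->
  (forall A, measurable A -> m (f1 @^-1` A) = mu A) ->
  (forall A, measurable A -> m (f2 @^-1` A) = nu A) ->
  exists2 pi, coupling mu nu pi &
    forall k : borel (prod_dist d d) -> \bar R,
      measurable_fun setT k -> (forall z, 0 <= k z)%E ->
      (\int[pi]_z k z = \int[m]_s k (f1 s, f2 s))%E.
Proof.
move=> mf1 mf2 f1mu f2nu.
have mf := measurable_pair_borel dP mf1 mf2.
have [m' m'E m'i] := ex_pushforward m mf.
have m'T : m' setT = 1%E.
  by rewrite m'E preimage_setT -(@preimage_setT _ _ f1) f1mu// probability_setT.
have [pi piE] := ex_probability m'T.
exists pi; last by move=> k mk k0; rewrite piE m'i.
move=> A mA; rewrite /pushforward piE !m'E; split; [exact: f1mu|exact: f2nu].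
Qed.

Lemma ex_coupling mu nu : exists pi, coupling mu nu pi.
Proof.
have c12 k : mu (cst 0%N @^-1` [set k]) = nu (cst 0%N @^-1` [set k]).
  rewrite !preimage_cst; case: ifP => _; first by rewrite !probability_setT.
  by rewrite !measure0.
have [m [m1 m2 _]] := ex_glue (measurable_cst _) (measurable_cst _) c12.
have [||A mA|A mA|pi cpi _] := @ex_coupling_pushforward _ _ m fst snd mu nu.
- exact: measurable_fst.
- exact: measurable_snd.
- by rewrite -m1// setXT.
- by rewrite -m2// setTX.
- by exists pi.
Qed.

Lemma transport_cost_ge0 pi : (0 <= @transport_cost R T d pi)%E.
Proof. by apply: integral_ge0 => z _; rewrite lee_fin sqr_ge0. Qed.

Lemma transport_cost_le mu nu pi p (a b : R) : coupling mu nu pi ->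
  (\int[mu]_x (d p x ^+ 2)%:E <= a%:E)%E ->
  (\int[nu]_x (d p x ^+ 2)%:E <= b%:E)%E ->
  (transport_cost pi <= (2 * a + 2 * b)%:E)%E.
Proof.
move=> cpi ha hb; rewrite -[X in X%:E]addr0.
have mp := measurable_sqdistl p.
apply: (@integral_le_linear _ _ _ pi (fun z => d p z.1 ^+ 2) (fun z =>
  d p z.2 ^+ 2)) => //.
- exact: sprobability_setT.
- exact: (measurableT_comp mp (@measurable_fst_borel _ _ _)).
- exact: (measurableT_comp mp (@measurable_snd_borel _ _ _)).
- exact: measurable_sqdist.
- by move=> x; exact: sqr_ge0.
- by move=> x; exact: sqr_ge0.
- by move=> x; exact: sqr_ge0.
- by exists set0 => // z _; rewrite addr0 (spm_sym dP p z.1); exact: sqdist_le2.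
- rewrite (coupling_integral_fst cpi (k := fun x => (d p x ^+ 2)%:E))//.
    exact/measurable_EFinP.
  by move=> x; rewrite lee_fin sqr_ge0.
- rewrite (coupling_integral_snd cpi (k := fun x => (d p x ^+ 2)%:E))//.
    exact/measurable_EFinP.
  by move=> x; rewrite lee_fin sqr_ge0.
Qed.

Lemma transport_cost_fin (mu nu : W2 d) pi : coupling mu nu pi ->
  transport_cost pi \is a fin_num.
Proof.
move=> cpi.
have fin m : (\int[m]_x (d point x ^+ 2)%:E \is a fin_num)%E.
  rewrite ge0_fin_numE; first exact: W2_moment_lt.
  by apply: integral_ge0 => x _; rewrite lee_fin sqr_ge0.
rewrite ge0_fin_numE ?transport_cost_ge0//; apply: le_lt_trans (ltry _).
apply: (transport_cost_le cpi (p := point)).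
  by rewrite -[leLHS]fineK.
by rewrite -[leLHS]fineK.
Qed.

(** The infimum of the costs is finite, so that neither the truncation of
    [+oo] nor that of negative numbers plays a role in [dW]. *)
Lemma dW_sq (mu nu : W2 d) :
  ((dW mu nu ^+ 2)%:E = ereal_inf (@transport_cost R T d @` coupling mu nu))%E.
Proof.
have inf0 : (0 <= ereal_inf (@transport_cost R T d @` coupling mu nu))%E.
  by apply: le_ereal_inf_tmp => _ [pi _ <-]; exact: transport_cost_ge0.
rewrite /dW sqr_sqrtr ?fine_ge0// fineK// ge0_fin_numE//.
have [pi cpi] := ex_coupling mu nu.
apply: (@le_lt_trans _ _ (transport_cost pi)).
  by apply: ereal_inf_lbound; exists pi.
by rewrite -ge0_fin_numE ?transport_cost_ge0//; exact: transport_cost_fin cpi.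
Qed.

Lemma dW_sq_le (mu nu : W2 d) pi : coupling mu nu pi ->
  ((dW mu nu ^+ 2)%:E <= transport_cost pi)%E.
Proof.
move=> cpi; rewrite dW_sq.
by apply: ereal_inf_lbound; exists pi.
Qed.

Lemma dW_sq_optimal (mu nu : W2 d) pi : optimal_coupling mu nu pi ->
  ((dW mu nu ^+ 2)%:E = transport_cost pi)%E.
Proof.
move=> [cpi opt]; apply/eqP; rewrite eq_le dW_sq_le//= dW_sq.
by apply: le_ereal_inf_tmp => _ [pi' cpi' <-]; exact: opt.
Qed.

Lemma dW_sq_lt (mu nu : W2 d) (e : R) : dW mu nu ^+ 2 < e ->
  exists2 pi, coupling mu nu pi & (transport_cost pi <= e%:E)%E.
Proof.
rewrite -lte_fin dW_sq => /ereal_inf_lt[_ [pi cpi <-] h].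
by exists pi => //; exact: ltW.
Qed.

Lemma dW_ge0 (mu nu : W2 d) : 0 <= dW mu nu.
Proof. exact: sqrtr_ge0. Qed.

Lemma dW_refl (mu : W2 d) : dW mu mu = 0.
Proof.
have [||//|//|pi cpi ci] := @ex_coupling_pushforward _ _ mu id id mu mu.
- exact: measurable_id.
- exact: measurable_id.
apply/eqP; rewrite -sqrf_eq0 eq_le sqr_ge0 andbT -lee_fin.
apply: le_trans (dW_sq_le cpi) _.
rewrite /transport_cost ci.
- by rewrite integral0_eq// => x _; rewrite (spm_refl dP) expr0n.
- by apply/measurable_EFinP; exact: measurable_sqdist.
- by move=> z; rewrite lee_fin sqr_ge0.
Qed.

(** A triangle inequality for squared distances. Plans from [mu] to [nu] and
    from [nu] to [rho] are glued along cells of diameter [e] of the middle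
    space, which adds an error of order [e] that tends to 0. *)
Lemma dW_quasi_triangle (t : R) (mu nu rho : W2 d) : 0 < t ->
  dW mu rho ^+ 2 <= (1 + t) * dW mu nu ^+ 2 + 2 * (1 + t^-1) * dW nu rho ^+ 2.
Proof.
move=> t0; set A := dW mu nu ^+ 2; set B := dW nu rho ^+ 2.
have s0 : 0 < t^-1 by rewrite invr_gt0.
suff step (e : R) : 0 < e -> dW mu rho ^+ 2 <=
    (1 + t) * (A + e) + 2 * (1 + t^-1) * (B + e) + 2 * (1 + t^-1) * e ^+ 2.
  apply/ler_addgt0Pr => e e0.
  pose K := (1 + t) + 4 * (1 + t^-1).
  have K0 : 0 < K by rewrite /K; lra.
  pose e1 := Num.min 1 (e / K).
  have e10 : 0 < e1 by rewrite lt_min ltr01 divr_gt0.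
  have e1K : K * e1 <= e by rewrite mulrC -ler_pdivlMr// ge_min lexx orbT.
  have e12 : e1 ^+ 2 <= e1.
    by rewrite expr2 ler_piMr ?ge_min ?lexx// ltW.
  apply: le_trans (step _ e10) _.
  have : 2 * (1 + t^-1) * e1 ^+ 2 <= 2 * (1 + t^-1) * e1 by rewrite ler_wpM2l//; lra.
  by move: e1K; rewrite /K; lra.
move=> e0.
have [pi1 cpi1 cost1] : exists2 pi,
  coupling mu nu pi & (transport_cost pi <= (A + e)%:E)%E.
  by apply: dW_sq_lt; rewrite ltrDl.
have [pi2 cpi2 cost2] : exists2 pi,
  coupling nu rho pi & (transport_cost pi <= (B + e)%:E)%E.
  by apply: dW_sq_lt; rewrite ltrDl.
have [c mc cE] := ex_cells dP e0.
have mc1 := measurableT_comp mc (@measurable_snd_borel _ _ d).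
have mc2 := measurableT_comp mc (@measurable_fst_borel _ _ d).
have mck k : measurable (c @^-1` [set k]) by rewrite -[X in measurable X]setTI;
  exact: mc.
have [|m [m1 m2 m12]] := @ex_glue R _ _ _ _ pi1 pi2 _ _ mc1 mc2.
  by move=> k; rewrite [LHS](cpi1 _ (mck k)).2 -(cpi2 _ (mck k)).1.
have m1' A' : measurable A' -> m (fst @^-1` A') = pi1 A'.
  by move=> mA; rewrite -m1// setXT.
have m2' A' : measurable A' -> m (snd @^-1` A') = pi2 A'.
  by move=> mA; rewrite -m2// setTX.
have mf1 : measurable_fun setT (fst \o fst : borel (prod_dist d d) * borel (prod_dist
  d d) -> borel d).
  exact: measurableT_comp (@measurable_fst_borel _ _ d) measurable_fst.
have mf2 : measurable_fun setT (snd \o snd : borel (prod_dist d d) * borel (prod_dist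
  d d) -> borel d).
  exact: measurableT_comp (@measurable_snd_borel _ _ d) measurable_snd.
have msnd A' : measurable A' -> measurable ((snd : borel (prod_dist d d) ->
  borel d) @^-1` A').
  by move=> mA; rewrite -[X in measurable X]setTI; exact: measurable_snd_borel.
have mfst A' : measurable A' -> measurable ((fst : borel (prod_dist d d) ->
  borel d) @^-1` A').
  by move=> mA; rewrite -[X in measurable X]setTI; exact: measurable_fst_borel.
have [A' mA'|A' mA'|pi cpi pii] := @ex_coupling_pushforward _ _ m _ _ mu rho mf1 mf2.
- exact: etrans (m1' _ (mfst _ mA')) (cpi1 _ mA').1.
- exact: etrans (m2' _ (msnd _ mA')) (cpi2 _ mA').2.
rewrite -lee_fin; apply: le_trans (dW_sq_le cpi) _.
have msq := measurable_sqdist.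
rewrite /transport_cost pii; last 2 first.
- exact/measurable_EFinP.
- by move=> z; rewrite lee_fin sqr_ge0.
have marg1 : (\int[m]_z (d z.1.1 z.1.2 ^+ 2)%:E <= (A + e)%:E)%E.
  apply: le_trans cost1.
  have [m' m'E m'i] := ex_pushforward m (@measurable_fst _ _ (borel (prod_dist d d))
    (borel (prod_dist d d))).
  rewrite -(m'i (fun z => (d z.1 z.2 ^+ 2)%:E)).
  - rewrite /transport_cost (eq_integral_measure (m2 := pi1))// => A' mA'.
    by rewrite m'E m1'.
  - exact/measurable_EFinP.
  - by move=> z; rewrite lee_fin sqr_ge0.
have marg2 : (\int[m]_z (d z.2.1 z.2.2 ^+ 2)%:E <= (B + e)%:E)%E.
  apply: le_trans cost2.
  have [m' m'E m'i] := ex_pushforward m (@measurable_snd _ _ (borel (prod_dist d d))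
    (borel (prod_dist d d))).
  rewrite -(m'i (fun z => (d z.1 z.2 ^+ 2)%:E)).
  - rewrite /transport_cost (eq_integral_measure (m2 := pi2))// => A' mA'.
    by rewrite m'E m2'.
  - exact/measurable_EFinP.
  - by move=> z; rewrite lee_fin sqr_ge0.
apply: (@integral_le_linear _ _ _ m (fun z => d z.1.1 z.1.2 ^+ 2) (fun z =>
  d z.2.1 z.2.2 ^+ 2)) => //.
- by rewrite -setXTT m1//; exact: sprobability_setT.
- exact: (measurableT_comp msq measurable_fst).
- exact: (measurableT_comp msq measurable_snd).
- exact: (measurableT_comp msq (measurable_pair_borel dP mf1 mf2)).
- by move=> x; exact: sqr_ge0.
- by move=> x; exact: sqr_ge0.
- by move=> x; exact: sqr_ge0.
- lra.
- by rewrite mulr_ge0//; lra.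
- by rewrite mulr_ge0 ?sqr_ge0//; lra.
- exists [set z : borel (prod_dist d d) * borel (prod_dist d d) | c z.1.2 != c
  z.2.1]; first split => //.
    have mN : measurable_fun setT (fun z : borel (prod_dist d d) * borel (prod_dist d
      d) =>
        c z.1.2 == c z.2.1).
      apply: measurable_fun_eqn.
        exact: (measurableT_comp mc1 measurable_fst).
      exact: (measurableT_comp mc2 measurable_snd).
    have := mN measurableT [set false] I; rewrite setTI; congr measurable.
    by apply/seteqP; split => z /=; [move=> ->|case: eqP].
  move=> [[x y] [y' z]] /= /negP; rewrite negbK => /eqP /cE yy'.
  have h1 := @sqdist_le t x y z t0.
  have h2 := spm_triangle dP y' y z.
  have h3 : d y z ^+ 2 <= 2 * d y' z ^+ 2 + 2 * e ^+ 2.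
    have p1 := spm_ge0 dP y z; have p2 := spm_ge0 dP y y'; have p3 := spm_ge0 dP y' z.
    apply: (@le_trans _ _ ((e + d y' z) ^+ 2)).
      have e0' := ltW e0; rewrite ler_pXn2r ?nnegrE ?addr_ge0//.
      by apply: le_trans h2 _; rewrite lerD2r ltW.
    rewrite -subr_ge0 (_ : _ - _ = (e - d y' z) ^+ 2) ?sqr_ge0//; ring.
  have h4 : (1 + t^-1) * d y z ^+ 2 <= (1 + t^-1) * (2 * d y' z ^+ 2 + 2 * e ^+ 2).
    by rewrite ler_wpM2l//; lra.
  apply: le_trans h1 _; rewrite -addrA lerD2l; apply: le_trans h4 _.
  by rewrite le_eqVlt; apply/orP; left; apply/eqP; ring.
Qed.
End wasserstein.

(** * Couplings of a measure with itself of small cost *)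

Section continuity_in_measure.
Context (R : realType) (T : pointedType) (d : T -> T -> R).
Hypothesis dP : separable_pseudometric d.
Variable mu : probability (borel d) R.

(** The pairs that leave [A]. *)
Definition exit (A : set T) : set (borel (prod_dist d d)) :=
  [set z | A z.1 /\ ~ A z.2].

(** Under a coupling of [mu] with itself, the probability of leaving [A] tends
    to 0 with the cost. *)
Definition rarely_exited (A : set T) : Prop :=
  forall e : R, 0 < e -> exists2 a : R, 0 < a &
    forall pi, coupling mu mu pi -> (transport_cost pi <= a%:E)%E ->
      (pi (exit A) <= e%:E)%E.

Let mfst (A : set (borel d)) : measurable A ->
  measurable ((fst : borel (prod_dist d d) -> borel d) @^-1` A).
Proof. by move=> mA; rewrite -[X in measurable X]setTI;
  exact: measurable_fst_borel. Qed.

Let msnd (A : set (borel d)) : measurable A ->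
  measurable ((snd : borel (prod_dist d d) -> borel d) @^-1` A).
Proof. by move=> mA; rewrite -[X in measurable X]setTI;
  exact: measurable_snd_borel. Qed.

Lemma measurable_exit (A : set (borel d)) : measurable A -> measurable (exit A).
Proof.
move=> mA; rewrite (_ : exit A = fst @^-1` A `&` ~` (snd @^-1` A))//.
by apply: measurableI; [exact: mfst|apply: measurableC; exact: msnd].
Qed.

Lemma rarely_exited0 : rarely_exited set0.
Proof.
move=> e e0; exists 1 => // pi _ _.
rewrite (_ : exit _ = set0) ?measure0 ?lee_fin 1?ltW//.
by apply/seteqP; split => z // [].
Qed.

(** As both marginals are [mu], a coupling enters [A] with the same probability
    as it leaves it. *)
Lemma rarely_exitedC (A : set (borel d)) : measurable A ->
  rarely_exited A -> rarely_exited (~` A).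
Proof.
move=> mA rA e /rA[a a0 Ha]; exists a => // pi cpi /(Ha _ cpi); apply: le_trans.
pose B := (fst : borel (prod_dist d d) ->
  borel d) @^-1` A `&` (snd : borel (prod_dist d d) -> borel d) @^-1` A.
have mB : measurable B by apply: measurableI; [exact: mfst|exact: msnd].
have mE := measurable_exit mA.
have mEC := measurable_exit (measurableC mA).
have h1 : (pi (exit A) + pi B = mu A)%E.
  rewrite -(cpi _ mA).1 /pushforward -measureU//.
    congr (pi _); apply/seteqP; split => z /=; first by move=> [[]|[]].
    by move=> Az; have [Az2|Az2] := pselect (A z.2); [right|left].
  by apply/seteqP; split => // z [[_ nA] [_ /nA]].
have h2 : (pi (exit (~` A)) + pi B = mu A)%E.
  rewrite -(cpi _ mA).2 /pushforward -measureU//.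
    congr (pi _); apply/seteqP; split => z /=; first by move=> [[_ /contrapT]|[]].
    move=> Az; have [Az2|Az2] := pselect (A z.1); [by right|left].
    by split => //; apply.
  by apply/seteqP; split => // z [[nA _] [/nA]].
have Bfin : pi B \is a fin_num by exact: fin_num_measure.
by rewrite -(leeD2rE _ _ Bfin) h1 h2.
Qed.

Lemma rarely_exitedU (A B : set (borel d)) : measurable A -> measurable B ->
  rarely_exited A -> rarely_exited B -> rarely_exited (A `|` B).
Proof.
move=> mA mB rA rB e e0; have e20 : 0 < e / 2 by rewrite divr_gt0.
have [a a0 Ha] := rA _ e20; have [b b0 Hb] := rB _ e20.
exists (Num.min a b); first by rewrite lt_min a0.
move=> pi cpi; rewrite EFin_min le_min => /andP[/(Ha _ cpi) ha /(Hb _ cpi) hb].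
apply: (@le_trans _ _ (pi (exit A `|` exit B))).
  apply: le_measure; rewrite ?inE.
  - by apply: measurable_exit; exact: measurableU.
  - by apply: measurableU; exact: measurable_exit.
  - by move=> z /= [[Az|Bz] /not_orP[nA nB]]; [left|right].
apply: le_trans (measureU2 _ (measurable_exit mA) (measurable_exit mB)) _.
by rewrite [e]splitr EFinD leeD.
Qed.

(** It is enough to control, for an increasing sequence of sets [B n] that
    exhausts [A], the probability of going from [B n] out of [A]. *)
Lemma rarely_exited_approx (A : set (borel d)) (B : nat -> set (borel d)) :
  measurable A -> (forall n, measurable (B n)) ->
  (forall n, B n `<=` A) -> {homo B : m n / (m <= n)%N >-> m `<=` n} ->
    A `<=` \bigcup_n B n ->
  (forall n e, 0 < e -> exists2 a : R, 0 < a &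
    forall pi, coupling mu mu pi -> (transport_cost pi <= a%:E)%E ->
      (pi [set z | B n z.1 /\ ~ A z.2] <= e%:E)%E) ->
  rarely_exited A.
Proof.
move=> mA mB BA ndB AB H e e0; have e20 : 0 < e / 2 by rewrite divr_gt0.
have [n hn] : exists n, (mu (A `\` B n) <= (e / 2)%:E)%E.
  have cv : (fun n => mu (A `\` B n)) @ \oo --> mu (\bigcap_n (A `\` B n)).
    apply: nonincreasing_cvg_mu.
    - by rewrite -ge0_fin_numE//; apply: fin_num_measure; exact: measurableD.
    - by move=> i; exact: measurableD.
    - by apply: bigcapT_measurable => i; exact: measurableD.
    - by move=> i j ij; apply/subsetPset; apply: setDS; exact: ndB.
  have cap0 : \bigcap_n (A `\` B n) = set0.
    apply/seteqP; split => // x h; have [Ax _] := h 0%N I.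
    by have [n _ Bn] := AB _ Ax; case: (h n I).
  rewrite cap0 measure0 in cv.
  have /cv[n _ hn] : nbhs (0 : \bar R)%E [set x | (x < (e / 2)%:E)%E].
    apply: (@open_nbhs_nbhs _ (0 : \bar R)%E); split => /=; last by rewrite lte_fin.
    exact: open_ereal_lt_ereal.
  by exists n; apply: ltW; apply: (hn n); rewrite /=.
have [a a0 Ha] := H n _ e20.
exists a => // pi cpi /(Ha _ cpi) ha.
have mE : measurable ([set z | B n z.1 /\ ~ A z.2] : set (borel (prod_dist d d))).
  rewrite (_ : [set _ | _] = fst @^-1` (B n) `&` ~` (snd @^-1` A))//.
  by apply: measurableI; [exact: mfst|apply: measurableC; exact: msnd].
have mD : measurable ((fst : borel (prod_dist d d) -> borel d) @^-1` (A `\` B n)).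
  by apply: mfst; exact: measurableD.
apply: (@le_trans _ _ (pi (fst @^-1` (A `\` B n) `|` [set z | B n z.1 /\ ~ A z.2]))).
  apply: le_measure; rewrite ?inE.
  - exact: measurable_exit.
  - exact: measurableU.
  - by move=> z /= [Az1 nAz2]; have [Bz|Bz] := pselect (B n z.1); [right|left].
apply: le_trans (measureU2 _ mD mE) _.
rewrite [e]splitr EFinD leeD//.
by move: hn; rewrite -(cpi _ (measurableD mA (mB n))).1.
Qed.

Lemma rarely_exited_bigcup (F : nat -> set (borel d)) :
  (forall n, measurable (F n)) -> (forall n, rarely_exited (F n)) ->
  rarely_exited (\bigcup_n F n).
Proof.
move=> mF rF; pose B n := \big[setU/set0]_(i < n) F i.
have mB n : measurable (B n) by apply: bigsetU_measurable => i _; exact: mF.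
have rB n : rarely_exited (B n).
  elim: n => [|n IH]; first by rewrite /B big_ord0; exact: rarely_exited0.
  by rewrite /B big_ord_recr/=; exact: (rarely_exitedU (mB n) (mF n) IH (rF n)).
apply: (@rarely_exited_approx _ B) => //.
- exact: bigcupT_measurable.
- by move=> n; exact: bigsetU_bigcup.
- by move=> i j ij; exact: subset_bigsetU.
- by move=> x [n _ Fx]; exists n.+1 => //; rewrite /B big_ord_recr/=; right.
- move=> n e /(rB n)[a a0 Ha]; exists a => // pi cpi /(Ha _ cpi); apply: le_trans.
  apply: le_measure; rewrite ?inE.
  + rewrite (_ : [set _ | _] = fst @^-1` (B n) `&` ~` (snd @^-1` (\bigcup_n F n)))//.
    by apply: measurableI; [exact: mfst|apply: measurableC; apply: msnd;
      exact: bigcupT_measurable].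
  + exact: measurable_exit.
  + move=> z /= [Bz nF]; split => //; apply: contra_not nF; exact: bigsetU_bigcup.
Qed.

Lemma dist_markov (r : R) pi (B : set (borel (prod_dist d d))) : 0 < r ->
  measurable B ->
  (forall z, B z -> r <= d z.1 z.2) ->
  forall a : R, (transport_cost pi <= a%:E)%E -> (pi B <= (r ^- 2 * a)%:E)%E.
Proof.
move=> r0 mB Br a ha.
rewrite -[X in (pi X <= _)%E]setIT -integral_indic//.
have -> : r ^- 2 * a = r ^- 2 * a + 0 * a + 0 by rewrite mul0r !addr0.
apply: (@integral_le_linear _ _ _ pi (fun z => d z.1 z.2 ^+ 2) (fun z =>
  d z.1 z.2 ^+ 2)) => //.
- exact: sprobability_setT.
- exact: measurable_sqdist.
- exact: measurable_sqdist.
- by move=> z; exact: sqr_ge0.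
- by move=> z; exact: sqr_ge0.
- by rewrite invr_ge0 sqr_ge0.
exists set0 => // z _; rewrite mul0r !addr0 indicE.
have [/set_mem Bz|_] := boolP (z \in B); last by rewrite mulr_ge0// ?invr_ge0 sqr_ge0.
rewrite mulrC ler_pdivlMr ?exprn_gt0// mul1r ler_pXn2r ?nnegrE ?(spm_ge0 dP)// ?Br//.
exact: ltW.
Qed.

(** An open set is exhausted by its subsets of points at distance at least
    [1 / n.+1] of the complement, and leaving it from there costs at least
    [1 / n.+1 ^ 2] per unit of mass. *)
Lemma rarely_exited_dopen (U : set T) : dopen d U -> rarely_exited U.
Proof.
move=> dU.
pose r (n : nat) : R := n.+1%:R^-1.
have r0 n : 0 < r n by rewrite invr_gt0.
pose B n : set (borel d) := [set x | forall y, d x y < r n -> U y].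
have mB n : measurable (B n).
  rewrite -[B n]setCK; apply: measurableC; apply: measurable_dopen =>
    x /= /existsNP[y /not_implyP[xy nU]].
  exists (r n - d x y); first by rewrite subr_gt0.
  move=> x' xx' /= h; apply: nU; apply: h.
  apply: le_lt_trans (spm_triangle dP x x' y) _.
  by rewrite (spm_sym dP x') -ltrBrDr.
apply: (@rarely_exited_approx _ B) => //.
- exact: measurable_dopen.
- by move=> n x; apply; rewrite (spm_refl dP).
- move=> i j ij x Bx y xy; apply: Bx; apply: lt_le_trans xy _.
  by rewrite lef_pV2 ?posrE// ler_nat.
- move=> x /dU[e e0 eU].
  exists (Num.truncn e^-1) => // y xy; apply: eU; apply: lt_trans xy _.
  by rewrite /r invf_plt ?posrE// truncnS_gt.
- move=> n e e0; exists (r n ^+ 2 * e); first by rewrite mulr_gt0 ?exprn_gt0.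
  move=> pi cpi ha.
  have mE : measurable ([set z | B n z.1 /\ ~ U z.2] : set (borel (prod_dist d d))).
    rewrite (_ : [set _ | _] = fst @^-1` (B n) `&` ~` (snd @^-1` U))//.
    apply: measurableI; [exact: mfst|apply: measurableC; apply: msnd].
    exact: measurable_dopen.
  apply: le_trans (dist_markov (r0 n) mE _ ha) _.
    by move=> z /= [Bz nU]; rewrite leNgt; apply: contra_notN nU; exact: Bz.
  by rewrite mulrA mulVf ?mul1r// expf_neq0// gt_eqF.
Qed.

Lemma rarely_exited_measurable (A : set (borel d)) : measurable A -> rarely_exited A.
Proof.
suff : <<s dopen d >> `<=` [set A : set (borel d) | measurable A /\ rarely_exited A].
  by move=> h /h[].
apply: smallest_sub.
  split.
  - by split => //; exact: rarely_exited0.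
  - move=> B [mB rB]; rewrite setTD; split; first exact: measurableC.
    exact: rarely_exitedC.
  - move=> F FP; split; first by apply: bigcupT_measurable => n; case: (FP n).
    by apply: rarely_exited_bigcup => n; case: (FP n).
by move=> U dU; split; [exact: measurable_dopen|exact: rarely_exited_dopen].
Qed.

(** A bounded measurable function rarely decreases along a coupling of [mu]
    with itself of small cost: decreasing by more than [e / 2] means leaving one
    of the finitely many level sets [j * (e / 2) <= g]. *)
Lemma rarely_decreases (g : borel d -> R) (M : R) :
  measurable_fun setT g -> (forall x, 0 <= g x) -> (forall x, g x <= M) ->
  forall e : R, 0 < e -> exists2 a : R, 0 < a &
    forall pi, coupling mu mu pi -> (transport_cost pi <= a%:E)%E ->
      (\int[pi]_z (Num.max 0 (g z.1 - g z.2))%:E <= e%:E)%E.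
Proof.
move=> mg g0 gM e e0; have M0 : 0 <= M := le_trans (g0 point) (gM point).
have M10 : 0 < M + 1 by rewrite ltr_wpDl.
have e20 : 0 < e / 2 by rewrite divr_gt0.
pose A (j : nat) : set (borel d) := [set x | j%:R * (e / 2) <= g x].
have mA j : measurable (A j).
  rewrite (_ : A j = g @^-1` `[j%:R * (e / 2), +oo[).
    by rewrite -[X in measurable X]setTI; exact: mg.
  by apply/seteqP; split => x; rewrite /A/= in_itv/= andbT.
pose E n := \big[setU/set0]_(i < n) exit (A i).
have mE n : measurable (E n).
  by apply: bigsetU_measurable => i _; exact: measurable_exit.
have rE n (b : R) : 0 < b -> exists2 a : R, 0 < a &
    forall pi, coupling mu mu pi -> (transport_cost pi <= a%:E)%E ->
      (pi (E n) <= b%:E)%E.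
  elim: n b => [|n IH] b b0.
    by exists 1 => // pi _ _; rewrite /E big_ord0 measure0 lee_fin ltW.
  have b20 : 0 < b / 2 by rewrite divr_gt0.
  have [a1 a10 H1] := IH _ b20; have [a2 a20 H2] := rarely_exited_measurable (mA n) b20.
  exists (Num.min a1 a2); first by rewrite lt_min a10.
  move=> pi cpi; rewrite EFin_min le_min => /andP[/(H1 _ cpi) h1 /(H2 _ cpi) h2].
  rewrite /E big_ord_recr/=.
  apply: le_trans (measureU2 _ (mE n) (measurable_exit (mA n))) _.
  by rewrite [b]splitr EFinD leeD.
pose N := (Num.truncn (M / (e / 2))).+1.
have b0 : 0 < e / 2 / (M + 1) by rewrite divr_gt0.
have [a a0 Ha] := rE N _ b0; exists a => // pi cpi /(Ha _ cpi) ha.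
have mg1 := measurableT_comp mg (@measurable_fst_borel _ _ d).
have mg2 := measurableT_comp mg (@measurable_snd_borel _ _ d).
have -> : e = (M + 1) * (e / 2 / (M + 1)) + 0 * (e / 2 / (M + 1)) + e / 2.
  by rewrite mul0r addr0 mulrC divfK ?gt_eqF// -splitr.
apply: (@integral_le_linear _ _ _ pi (\1_(E N)) (\1_(E N))) => //.
- exact: sprobability_setT.
- by apply: measurable_maxr => //; exact: measurable_funB.
- by move=> z; rewrite le_max lexx.
- exact: ltW.
- exact: ltW.
- exists set0 => // z _; rewrite mul0r addr0 indicE.
  have gd : g z.1 - g z.2 <= M by rewrite lerBlDr ler_wpDr.
  have [zE|zE] := boolP (z \in E N).
    by rewrite mulr1 ge_max; apply/andP; split; lra.
  rewrite mulr0 add0r ge_max (ltW e20) /= leNgt; apply/negP => h.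
  move/negP: zE; apply; rewrite inE; rewrite /E -(bigcup_mkord _ (fun i => exit (A i))).
  pose j := Num.truncn (g z.1 / (e / 2)).
  have gz0 : 0 <= g z.1 / (e / 2) by rewrite divr_ge0// ltW.
  have /andP[j1 j2] := truncn_itv gz0.
  rewrite -/j ler_pdivlMr// in j1; rewrite -/j ltr_pdivrMr// -natr1 in j2.
  exists j => /=.
    rewrite /N ltnS; apply: le_truncn.
    by rewrite ler_pM2r// invr_gt0.
  by split => //=; apply/negP; rewrite -ltNge; lra.
- by rewrite integral_indic// setIT.
- by rewrite integral_indic// setIT.
Qed.
End continuity_in_measure.

(** The part of an integrable function above a large level has a small
    integral. *)
Lemma ex_small_tail (R : realType) disp (S : measurableType disp)
    (m : {measure set S -> \bar R}) (f : S -> R) :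
  measurable_fun setT f -> (forall x, 0 <= f x) -> (\int[m]_x (f x)%:E < +oo)%E ->
  forall e : R, 0 < e -> exists2 K : R, 0 <= K &
    (\int[m]_x (Num.max 0 (f x - K))%:E <= e%:E)%E.
Proof.
move=> mf f0 foo e e0.
have [] := @dominated_convergence _ _ _ m setT measurableT
  (fun n x => (Num.max 0 (f x - n%:R))%:E) (cst 0%E) (fun x => (f x)%:E).
- move=> n; apply/measurable_EFinP; apply: measurable_maxr => //.
  exact: measurable_funB.
- exact: measurable_cst.
- apply: aeW => x _; apply: cvg_near_cst.
  exists (Num.truncn (f x)).+1 => // n /= hn; congr EFin.
  apply/max_idPl; rewrite subr_le0; apply: ltW.
  by apply: lt_le_trans (truncnS_gt _) _; rewrite ler_nat.
- apply/integrableP; split; first exact/measurable_EFinP.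
  by under eq_integral do rewrite gee0_abs ?lee_fin//.
- apply: aeW => x n _; rewrite gee0_abs ?lee_fin ?le_max ?lexx//.
  by rewrite ge_max f0 lerBlDr lerDl ler0n.
move=> _ _; rewrite integral0 => cv.
have /cv[n _ hn] : nbhs (0 : \bar R)%E [set x | (x < e%:E)%E].
  apply: (@open_nbhs_nbhs _ (0 : \bar R)%E); split => /=; last by rewrite lte_fin.
  exact: open_ereal_lt_ereal.
by exists n%:R => //; apply: ltW; apply: (hn n); rewrite /=.
Qed.

(** * Continuity of the restriction of a plan *)

Lemma ex_coupling_equal_mass (R : realType) d1 d2 (S1 : measurableType d1)
    (S2 : measurableType d2) (m1 : {measure set S1 -> \bar R})
    (m2 : {measure set S2 -> \bar R}) :
  (m1 setT < +oo)%E -> m1 setT = m2 setT ->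
  exists2 m : {measure set (S1 * S2) -> \bar R},
    forall A, measurable A -> m (fst @^-1` A) = m1 A &
    forall B, measurable B -> m (snd @^-1` B) = m2 B.
Proof.
move=> m1oo m12; have m2oo : (m2 setT < +oo)%E by rewrite -m12.
pose n1 := mfrestr measurableT m1oo; pose n2 := mfrestr measurableT m2oo.
have n1E A : n1 A = m1 A by rewrite /n1 /mfrestr /mrestr setIT.
have n2E A : n2 A = m2 A by rewrite /n2 /mfrestr /mrestr setIT.
have c12 k : n1 (cst 0%N @^-1` [set k]) = n2 (cst 0%N @^-1` [set k]).
  by rewrite !preimage_cst n1E n2E; case: ifP => // _; rewrite !measure0.
have [m [h1 h2 _]] := ex_glue (measurable_cst _) (measurable_cst _) c12.
exists m => A mA; first by rewrite -setXT; exact: etrans (h1 _ mA) (n1E A).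
by rewrite -setTX; exact: etrans (h2 _ mA) (n2E A).
Qed.

Lemma min_add_max0 (R : realDomainType) (a b : R) : a = Num.min a b + Num.max 0 (a - b).
Proof. by case: (leP a b) => ?; case: leP => ?; lra. Qed.

Section restriction_continuity.
Context (R : realType) (T : pointedType) (d : T -> T -> R).
Hypothesis dP : separable_pseudometric d.
Local Notation D := (prod_dist d d).
Let DP : separable_pseudometric D := separable_pseudometric_prod dP.
Context (mu nu : W2 d) (m : probability (borel d) R) (g : borel d -> R).
Context (gm : bounded_density mu m g).

Let mg : measurable_fun setT g. Proof. by case: gm. Qed.
Let g0 x : 0 <= g x. Proof. by case: gm => _ + _ _; exact. Qed.

Lemma integral_density1 : (\int[mu]_x (g x)%:E = 1)%E.
Proof.
case: gm => _ _ _ /(_ _ measurableT).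
by rewrite /mdensity probability_setT.
Qed.

Let Dsq (z : borel (prod_dist D D)) :
  D z.1 z.2 ^+ 2 = d z.1.1 z.2.1 ^+ 2 + d z.1.2 z.2.2 ^+ 2.
Proof. by rewrite /prod_dist sqr_sqrtr// addr_ge0 ?sqr_ge0. Qed.

(** The quantitative form of the continuity: [C] bounds the cost of a coupling
    [Ga] of the two plans, [th] the residual mass, and [e1] the tail above the
    level [K] of the squared distance to [p]. *)
Lemma dW_restricted_le (ga ga' : W2 D) (nu' : W2 d) (p : T) (M K C th e1 : R)
    (cga : coupling mu nu ga) (cga' : coupling mu nu' ga')
    (Ga : probability (borel (prod_dist D D)) R) :
  (forall x, g x <= M) -> 0 <= K -> coupling ga ga' Ga ->
  (transport_cost Ga <= C%:E)%E ->
  (\int[Ga]_z (Num.max 0 (g z.1.1 - g z.2.1))%:E <= th%:E)%E ->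
  (\int[nu]_y (Num.max 0 (d p y ^+ 2 - K))%:E <= e1%:E)%E ->
  dW (W2_restricted gm cga) (W2_restricted gm cga') ^+ 2 <=
    5 * M * C + 6 * K * th + 6 * M * e1.
Proof.
move=> gM K0 cGa costC thP e1P.
have M0 : 0 <= M := le_trans (g0 point) (gM point).
pose S := borel (prod_dist D D).
pose x1 : S -> borel d := fun z => z.1.1. pose y1 : S -> borel d := fun z => z.1.2.
pose x2 : S -> borel d := fun z => z.2.1. pose y2 : S -> borel d := fun z => z.2.2.
have mfst := @measurable_fst_borel R T d. have msnd := @measurable_snd_borel R T d.
have mFST := @measurable_fst_borel R _ D. have mSND := @measurable_snd_borel R _ D.
have mx1 : measurable_fun setT x1 by exact: measurableT_comp mfst mFST.
have my1 : measurable_fun setT y1 by exact: measurableT_comp msnd mFST.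
have mx2 : measurable_fun setT x2 by exact: measurableT_comp mfst mSND.
have my2 : measurable_fun setT y2 by exact: measurableT_comp msnd mSND.
have mgx1 := measurableT_comp mg mx1. have mgx2 := measurableT_comp mg mx2.
have int_x1 (k : borel d -> \bar R) : measurable_fun setT k -> (forall x, 0 <= k x)%E ->
    (\int[Ga]_z k (x1 z) = \int[mu]_x k x)%E.
  move=> mk k0; rewrite -(coupling_integral_fst cga mk k0).
  by rewrite -(coupling_integral_fst cGa (k := fun z => k z.1))//;
    exact: measurableT_comp mk mfst.
have int_x2 (k : borel d -> \bar R) : measurable_fun setT k -> (forall x, 0 <= k x)%E ->
    (\int[Ga]_z k (x2 z) = \int[mu]_x k x)%E.
  move=> mk k0; rewrite -(coupling_integral_fst cga' mk k0).
  by rewrite -(coupling_integral_snd cGa (k := fun z => k z.1))//;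
    exact: measurableT_comp mk mfst.
have int_y1 (k : borel d -> \bar R) : measurable_fun setT k -> (forall x, 0 <= k x)%E ->
    (\int[Ga]_z k (y1 z) = \int[nu]_x k x)%E.
  move=> mk k0; rewrite -(coupling_integral_snd cga mk k0).
  by rewrite -(coupling_integral_fst cGa (k := fun z => k z.2))//;
    exact: measurableT_comp mk msnd.
(* [h] is the mass moved along [Ga]; [k1] and [k2] are the residual masses at
   the source and at the target. *)
pose h z := Num.min (g (x1 z)) (g (x2 z)).
pose k1 z := Num.max 0 (g (x1 z) - g (x2 z)).
pose k2 z := Num.max 0 (g (x2 z) - g (x1 z)).
have hk1 z : g (x1 z) = h z + k1 z.
  exact: min_add_max0.
have hk2 z : g (x2 z) = h z + k2 z.
  by rewrite /h minC; exact: min_add_max0.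
have h0 z : 0 <= h z by rewrite le_min !g0.
have k10 z : 0 <= k1 z by rewrite le_max lexx.
have k20 z : 0 <= k2 z by rewrite le_max lexx.
have hM z : h z <= M by rewrite ge_min gM.
have k1M z : k1 z <= M by have := hk1 z; have := gM (x1 z); have := h0 z; lra.
have k2M z : k2 z <= M by have := hk2 z; have := gM (x2 z); have := h0 z; lra.
have mh : measurable_fun setT h by exact: measurable_minr.
have mk1 : measurable_fun setT k1.
  by apply: measurable_maxr => //; exact: measurable_funB.
have mk2 : measurable_fun setT k2.
  by apply: measurable_maxr => //; exact: measurable_funB.
have split_int (u v w : S -> R) : measurable_fun setT u -> measurable_fun setT v ->
    (forall z, 0 <= u z) -> (forall z, 0 <= v z) -> (forall z, w z = u z + v z) ->
    forall A, measurable A ->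
    (\int[Ga]_(z in A) (w z)%:E = \int[Ga]_(z in A) (u z)%:E + \int[Ga]_(z in A) (v
      z)%:E)%E.
  move=> mu' mv u0 v0 wE A mA; under eq_integral do rewrite wE EFinD.
  rewrite ge0_integralD//.
  - by move=> z _; rewrite lee_fin.
  - by apply: measurable_funTS; exact/measurable_EFinP.
  - by move=> z _; rewrite lee_fin.
  - by apply: measurable_funTS; exact/measurable_EFinP.
have int_gx1 : (\int[Ga]_z (g (x1 z))%:E = 1)%E.
  by rewrite (int_x1 (fun x => (g x)%:E)) ?integral_density1//; exact/measurable_EFinP.
have int_gx2 : (\int[Ga]_z (g (x2 z))%:E = 1)%E.
  by rewrite (int_x2 (fun x => (g x)%:E)) ?integral_density1//; exact/measurable_EFinP.
have s1 := split_int _ _ _ mh mk1 h0 k10 hk1. have s2 :=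
  split_int _ _ _ mh mk2 h0 k20 hk2.
have int0 (u : S -> R) A : (forall z, 0 <= u z) -> (0 <= \int[Ga]_(z in A) (u z)%:E)%E.
  by move=> u0; apply: integral_ge0 => z _; rewrite lee_fin.
have hfin : (\int[Ga]_z (h z)%:E \is a fin_num)%E.
  rewrite ge0_fin_numE ?int0//; apply: (@le_lt_trans _ _ 1%E); last exact: ltry.
  by rewrite -int_gx1 s1// leeDl// int0.
(* The residual masses are equal because both plans have first marginal [mu]. *)
have k12 : (\int[Ga]_z (k1 z)%:E = \int[Ga]_z (k2 z)%:E)%E.
  by apply/eqP; rewrite eq_le; apply/andP; split;
    rewrite -(leeD2lE _ _ hfin) -s1// -s2// int_gx1 int_gx2.
have k1le1 : (\int[Ga]_z (k1 z)%:E <= 1)%E.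
  by rewrite -int_gx1 s1// leeDr// int0.
have [rh rhE] := ex_density Ga mh h0.
have [r1 r1E] := ex_density Ga mk1 k10. have [r2 r2E] := ex_density Ga mk2 k20.
have r1T : r1 setT = (\int[Ga]_z (k1 z)%:E)%E by rewrite r1E.
have r2T : r2 setT = (\int[Ga]_z (k2 z)%:E)%E by rewrite r2E.
have [||q q1 q2] := @ex_coupling_equal_mass _ _ _ _ _ r1 r2.
- by rewrite r1T; apply: le_lt_trans k1le1 _; exact: ltry.
- by rewrite r1T r2T.
have qT : (q setT <= 1)%E by rewrite -(preimage_setT fst) q1// r1T.
have my1q : measurable_fun setT (y1 \o fst : S * S -> borel d)
  by exact: measurableT_comp my1 measurable_fst.
have my2q : measurable_fun setT (y2 \o snd : S * S -> borel d)
  by exact: measurableT_comp my2 measurable_snd.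
have [a1 a1E a1i] := ex_pushforward rh (measurable_pair_borel dP my1 my2).
have [b1 b1E b1i] := ex_pushforward q (measurable_pair_borel dP my1q my2q).
have [c cE ci] := ex_add a1 b1.
have preT d1 d2 (S1 : measurableType d1) (S2 : measurableType d2) (f : S1 -> S2) A :
    measurable_fun setT f -> measurable A -> measurable (f @^-1` A).
  by move=> mf mA; rewrite -[X in measurable X]setTI; exact: mf.
have restr1 (A : set (borel d)) : measurable A ->
    c (fst @^-1` A) = W2_restricted gm cga A.
  move=> mA; rewrite cE a1E b1E.
  rewrite (_ : q _ = r1 (y1 @^-1` A)); last by rewrite -q1//; exact: preT.
  rewrite rhE r1E /mdensity -s1; last exact: (preT _ _ _ _ _ _ my1 mA).
  transitivity (\int[ga]_(z in snd @^-1` A) (g z.1)%:E)%E; last by [].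
  rewrite integral_mkcond [RHS]integral_mkcond -(coupling_integral_fst cGa)//.
  - apply/(measurable_restrictT _ (preT _ _ _ _ _ _ msnd mA)).
    by apply: measurable_funTS; apply/measurable_EFinP; exact: measurableT_comp mg mfst.
  - by apply: erestrict_ge0 => z _; rewrite lee_fin.
have restr2 (A : set (borel d)) : measurable A ->
    c (snd @^-1` A) = W2_restricted gm cga' A.
  move=> mA; rewrite cE a1E b1E.
  rewrite (_ : q _ = r2 (y2 @^-1` A)); last by rewrite -q2//; exact: preT.
  rewrite rhE r2E /mdensity -s2; last exact: (preT _ _ _ _ _ _ my2 mA).
  transitivity (\int[ga']_(z in snd @^-1` A) (g z.1)%:E)%E; last by [].
  rewrite integral_mkcond [RHS]integral_mkcond -(coupling_integral_snd cGa)//.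
  - apply/(measurable_restrictT _ (preT _ _ _ _ _ _ msnd mA)).
    by apply: measurable_funTS; apply/measurable_EFinP; exact: measurableT_comp mg mfst.
  - by apply: erestrict_ge0 => z _; rewrite lee_fin.
have [pi cpi pii] := ex_coupling_pushforward dP mfst msnd restr1 restr2.
rewrite -lee_fin; apply: le_trans (dW_sq_le dP cpi) _.
have msq := measurable_sqdist dP. have mD := measurable_sqdist DP.
have mEsq : measurable_fun setT (fun z : borel D => (d z.1 z.2 ^+ 2)%:E).
  exact/measurable_EFinP.
have sq0 (z : borel D) : (0 <= (d z.1 z.2 ^+ 2)%:E)%E by rewrite lee_fin sqr_ge0.
rewrite /transport_cost pii// ci// a1i// b1i//=.
have mp := measurable_sqdistl dP p.
have mpy1 : measurable_fun setT (fun z => d p (y1 z) ^+ 2) := measurableT_comp mp my1.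
have mpy2 : measurable_fun setT (fun z => d p (y2 z) ^+ 2) := measurableT_comp mp my2.
have mty1 : measurable_fun setT (fun z => Num.max 0 (d p (y1 z) ^+ 2 - K)).
  by apply: measurable_maxr => //; exact: measurable_funB.
have tail0 z : 0 <= Num.max 0 (d p (y1 z) ^+ 2 - K) by rewrite le_max lexx.
have tailP : (\int[Ga]_z (Num.max 0 (d p (y1 z) ^+ 2 - K))%:E <= e1%:E)%E.
  rewrite (int_y1 (fun y => (Num.max 0 (d p y ^+ 2 - K))%:E))//.
    by apply/measurable_EFinP; apply: measurable_maxr => //; exact: measurable_funB.
  by move=> y; rewrite lee_fin le_max lexx.
have GaT : (Ga setT <= 1)%E by exact: sprobability_setT.
have dens (r : {measure set S -> \bar R}) (k u : S ->
  R) : r = mdensity Ga k :> (set S -> \bar R) ->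
    measurable_fun setT k -> (forall z, 0 <= k z) ->
    measurable_fun setT u -> (forall z, 0 <= u z) ->
    (\int[r]_z (u z)%:E = \int[Ga]_z (u z * k z)%:E)%E.
  move=> rE mk k0 mu' u0; rewrite (ge0_integral_density (m := Ga) mk k0).
  - by [].
  - by move=> A _; rewrite rE.
  - exact/measurable_EFinP.
  - by move=> z; rewrite lee_fin.
have costA : (\int[rh]_z (d (y1 z) (y2 z) ^+ 2)%:E <= (M * C + 0 * C + 0)%:E)%E.
  rewrite (dens _ _ (fun z => d (y1 z) (y2 z) ^+ 2) rhE mh h0); last 2 first.
  - exact: measurableT_comp msq (measurable_pair_borel dP my1 my2).
  - by move=> z; exact: sqr_ge0.
  apply: (integral_le_linear (f := fun z : S => D z.1 z.2 ^+ 2) (g := fun z : S =>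
    D z.1 z.2 ^+ 2)) => //.
  - apply: measurable_funM => //.
    exact: measurableT_comp msq (measurable_pair_borel dP my1 my2).
  - by move=> z; exact: sqr_ge0.
  - by move=> z; exact: sqr_ge0.
  - by move=> z; rewrite mulr_ge0 ?sqr_ge0.
  exists set0 => // z _; rewrite mul0r !addr0 mulrC.
  apply: (@le_trans _ _ (M * d (y1 z) (y2 z) ^+ 2)); first
    by rewrite ler_wpM2r ?sqr_ge0.
  by rewrite ler_wpM2l// Dsq lerDr sqr_ge0.
(* Up to the level [K] the residual mass is small; above it the tail is, and the
   density is at most [M]. *)
have costB1 : (\int[Ga]_z (d p (y1 z) ^+ 2 * k1 z)%:E <= (K * th + M * e1 + 0)%:E)%E.
  apply: (integral_le_linear (f := k1) (g := fun z =>
    Num.max 0 (d p (y1 z) ^+ 2 - K))) => //.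
  - exact: measurable_funM.
  - by move=> z; rewrite mulr_ge0 ?sqr_ge0.
  exists set0 => // z _; rewrite addr0.
  have h1 : d p (y1 z) ^+ 2 <= K + Num.max 0 (d p (y1 z) ^+ 2 - K).
    by rewrite -lerBlDl le_max lexx orbT.
  apply: (@le_trans _ _ ((K + Num.max 0 (d p (y1 z) ^+ 2 - K)) * k1 z)).
    by rewrite ler_wpM2r.
  by rewrite mulrDl lerD2l mulrC ler_wpM2r.
(* Only [nu] has a controlled tail, so [y'] is first replaced by [y] at the
   expense of the cost of [Ga]. *)
have costB2 : (\int[Ga]_z (d p (y2 z) ^+ 2 * k2 z)%:E <= (2 * K * th + 2 * M * (e1 +
  C) + 0)%:E)%E.
  pose u z := Num.max 0 (d p (y1 z) ^+ 2 - K) + D z.1 z.2 ^+ 2.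
  have u0 z : 0 <= u z by rewrite addr_ge0 ?sqr_ge0.
  have mu' : measurable_fun setT u by exact: measurable_funD.
  have uP : (\int[Ga]_z (u z)%:E <= (e1 + C)%:E)%E.
    rewrite (_ : e1 + C = 1 * e1 + 1 * C + 0); last by rewrite !mul1r addr0.
    apply: (integral_le_linear (f := fun z => Num.max 0 (d p (y1 z) ^+ 2 - K))
      (g := fun z : S => D z.1 z.2 ^+ 2)) => //.
    - by move=> z; exact: sqr_ge0.
    - by exists set0 => // z _; rewrite !mul1r addr0.
  apply: (integral_le_linear (f := k2) (g := u)) => //.
  - exact: measurable_funM.
  - by move=> z; rewrite mulr_ge0 ?sqr_ge0.
  - by rewrite mulr_ge0.
  - by rewrite mulr_ge0.
  - exists set0 => // z _; rewrite addr0.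
    have h1 : d p (y1 z) ^+ 2 <= K + Num.max 0 (d p (y1 z) ^+ 2 - K).
      by rewrite -lerBlDl le_max lexx orbT.
    have h3 : d (y1 z) (y2 z) ^+ 2 <= D z.1 z.2 ^+ 2 by rewrite Dsq lerDr sqr_ge0.
    apply: (@le_trans _ _ ((2 * K + 2 * u z) * k2 z)).
      rewrite ler_wpM2r//; apply: le_trans (sqdist_le2 dP p (y1 z) (y2 z)) _.
      by rewrite -!mulrDr ler_wpM2l// /u addrA lerD.
    by rewrite mulrDl lerD2l -mulrA -[leRHS]mulrA ler_wpM2l// mulrC ler_wpM2r.
  - by rewrite -k12.
have pushq (d1 : measure_display) (S1 : measurableType d1) (f : S * S ->
  S1) (r : {measure set S1 -> \bar R}) (k : S1 -> \bar R) :
    measurable_fun setT f -> (forall A, measurable A -> q (f @^-1` A) = r A) ->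
    measurable_fun setT k -> (forall z, 0 <= k z)%E ->
    (\int[q]_w k (f w) = \int[r]_z k z)%E.
  move=> mf qr mk k0; have [m' m'E m'i] := ex_pushforward q mf.
  by rewrite -m'i//; apply: eq_integral_measure => A mA; rewrite m'E qr.
have costB : (\int[q]_w (d (y1 w.1) (y2 w.2) ^+ 2)%:E <=
    (2 * (K * th + M * e1 + 0) + 2 * (2 * K * th + 2 * M * (e1 + C) + 0) + 0)%:E)%E.
  apply: (integral_le_linear (f := fun w : S * S => d p (y1 w.1) ^+ 2)
      (g := fun w : S * S => d p (y2 w.2) ^+ 2)) => //.
  - exact: measurableT_comp mpy1 measurable_fst.
  - exact: measurableT_comp mpy2 measurable_snd.
  - exact: measurableT_comp msq (measurable_pair_borel dP my1q my2q).
  - by move=> z; exact: sqr_ge0.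
  - by move=> z; exact: sqr_ge0.
  - by move=> z; exact: sqr_ge0.
  - exists set0 => // w _; rewrite addr0 (spm_sym dP p (y1 w.1)).
    exact: sqdist_le2.
  - rewrite (pushq _ _ fst r1 (fun z => (d p (y1 z) ^+ 2)%:E))//.
    + by rewrite (dens _ _ (fun z => d p (y1 z) ^+ 2) r1E)// => z; exact: sqr_ge0.
    + exact/measurable_EFinP.
    + by move=> z; rewrite lee_fin sqr_ge0.
  - rewrite (pushq _ _ snd r2 (fun z => (d p (y2 z) ^+ 2)%:E))//.
    + by rewrite (dens _ _ (fun z => d p (y2 z) ^+ 2) r2E)// => z; exact: sqr_ge0.
    + exact/measurable_EFinP.
    + by move=> z; rewrite lee_fin sqr_ge0.
apply: le_trans (leeD costA costB) _.
by rewrite -EFinD lee_fin le_eqVlt; apply/orP; left; apply/eqP; ring.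
Qed.

(** Restricting a plan is continuous among the plans with first marginal
    [mu]. *)
Lemma restricted_continuous (ga : W2 D) (cga : coupling mu nu ga) (e : R) : 0 < e ->
  exists2 a : R, 0 < a & forall (nu' : W2 d) (ga' : W2 D) (cga' : coupling mu nu' ga'),
    dW ga ga' < a -> dW (W2_restricted gm cga) (W2_restricted gm cga') < e.
Proof.
move=> e0; have [_ _ [M gM] _] := gm.
have M0 : 0 <= M := le_trans (g0 point) (gM point).
have M10 : 0 < M + 1 by rewrite ltr_wpDl.
have e20 : 0 < e ^+ 2 by rewrite exprn_gt0.
(* The three constants make each of the three terms of the bound at most
   [e ^+ 2 / 6]. *)
pose e1 := e ^+ 2 / (36 * (M + 1)).
have e10 : 0 < e1 by rewrite divr_gt0// mulr_gt0.
have [K K0 KP] := ex_small_tail (measurable_sqdistl dP point)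
  (fun x => sqr_ge0 _) (W2_moment_lt dP nu point) e10.
have K10 : 0 < K + 1 by rewrite ltr_wpDl.
pose th := e ^+ 2 / (36 * (K + 1)).
have th0 : 0 < th by rewrite divr_gt0// mulr_gt0.
have [a2 a20 a2P] := rarely_decreases dP mu mg g0 gM th0.
pose C := Num.min (e ^+ 2 / (30 * (M + 1))) a2.
have C0 : 0 < C by rewrite lt_min a20 divr_gt0// mulr_gt0.
exists (Num.sqrt C); first by rewrite sqrtr_gt0.
move=> nu' ga' cga' gaC.
have [Ga cGa costC] : exists2 pi, coupling ga ga' pi & (transport_cost pi <= C%:E)%E.
  apply: (dW_sq_lt DP); rewrite -(sqr_sqrtr (ltW C0)).
  by rewrite ltr_pXn2r ?nnegrE ?dW_ge0 ?sqrtr_ge0.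
have thP : (\int[Ga]_z (Num.max 0 (g z.1.1 - g z.2.1))%:E <= th%:E)%E.
  have mfst := @measurable_fst_borel R T d.
  have mx1 := measurableT_comp mfst (@measurable_fst_borel R _ D).
  have mx2 := measurableT_comp mfst (@measurable_snd_borel R _ D).
  have pfst (A : set (borel d)) : measurable A -> measurable ((fst : borel D ->
    borel d) @^-1` A).
    by move=> mA; rewrite -[X in measurable X]setTI; exact: mfst.
  have [A mA|A mA|pi cpi pii] :=
    @ex_coupling_pushforward _ _ _ dP _ _ Ga _ _ mu mu mx1 mx2.
  - exact: etrans (cGa _ (pfst _ mA)).1 (cga _ mA).1.
  - exact: etrans (cGa _ (pfst _ mA)).2 (cga' _ mA).1.
  have mm : measurable_fun setT (fun z : borel D => Num.max 0 (g z.1 - g z.2)).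
    apply: measurable_maxr => //; apply: measurable_funB.
      exact: measurableT_comp mg mfst.
    exact: measurableT_comp mg (@measurable_snd_borel R T d).
  have := a2P pi cpi; rewrite pii; last 2 first.
  - exact/measurable_EFinP.
  - by move=> z; rewrite lee_fin le_max lexx.
  apply; have msq := measurable_sqdist dP.
  rewrite /transport_cost pii; last 2 first.
  - exact/measurable_EFinP.
  - by move=> z; rewrite lee_fin sqr_ge0.
  apply: (@le_trans _ _ C%:E); last by rewrite lee_fin ge_min lexx orbT.
  apply: le_trans costC; apply: ge0_le_integral => //.
  - by move=> z _; rewrite lee_fin sqr_ge0.
  - apply/measurable_EFinP.
    exact: measurableT_comp msq (measurable_pair_borel dP mx1 mx2).
  - by apply/measurable_EFinP; exact: (measurable_sqdist DP).
  - by move=> z _; rewrite lee_fin Dsq lerDl sqr_ge0.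
have := dW_restricted_le cga cga' gM K0 cGa costC thP KP.
have h1 : 5 * M * C <= e ^+ 2 / 6.
  apply: (@le_trans _ _ (5 * (M + 1) * (e ^+ 2 / (30 * (M + 1))))).
    apply: ler_pM; [by rewrite mulr_ge0|exact: ltW|by rewrite ler_wpM2l ?lerDl|].
    by rewrite /C ge_min lexx.
  by rewrite le_eqVlt; apply/orP; left; apply/eqP; field; rewrite gt_eqF.
have h2 : 6 * K * th <= e ^+ 2 / 6.
  apply: (@le_trans _ _ (6 * (K + 1) * th)).
    by rewrite -!mulrA ler_wpM2l// ler_wpM2r ?ltW// ltrDl.
  by rewrite /th le_eqVlt; apply/orP; left; apply/eqP; field; rewrite gt_eqF.
have h3 : 6 * M * e1 <= e ^+ 2 / 6.
  apply: (@le_trans _ _ (6 * (M + 1) * e1)).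
    by rewrite -!mulrA ler_wpM2l// ler_wpM2r ?ltW// ltrDl.
  by rewrite /e1 le_eqVlt; apply/orP; left; apply/eqP; field; rewrite gt_eqF.
move=> h4; rewrite -(@ltr_pXn2r _ 2)// ?nnegrE ?dW_ge0 ?ltW//.
by apply: le_lt_trans h4 _; lra.
Qed.
End restriction_continuity.

(** * Restriction mappings and barycenters *)

Section barycenter.
Context (R : realType) (T : pointedType) (d : T -> T -> R).
Hypothesis dP : separable_pseudometric d.
Local Notation D := (prod_dist d d).
Let DP : separable_pseudometric D := separable_pseudometric_prod dP.

Lemma dopen_dW_sq (eta : W2 d) r : dopen (@dW R T d) [set nu | dW eta nu ^+ 2 < r].
Proof.
move=> nu /=; set A := dW eta nu ^+ 2 => Ar.
have A0 : 0 <= A by exact: sqr_ge0.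
have rA : 0 < r - A by rewrite subr_gt0.
pose t := (r - A) / (2 * (A + 1)).
have A10 : 0 < A + 1 by rewrite ltr_wpDl.
have t0 : 0 < t by rewrite divr_gt0// mulr_gt0.
have s0 : 0 < t^-1 by rewrite invr_gt0.
have c0 : 0 < 4 * (1 + t^-1) by lra.
pose b := (r - A) / (4 * (1 + t^-1)).
have b0 : 0 < b by rewrite divr_gt0.
exists (Num.sqrt b); first by rewrite sqrtr_gt0.
move=> nu' h.
have {}h : dW nu nu' ^+ 2 < b.
  rewrite -(sqr_sqrtr (ltW b0)).
  by rewrite ltr_pXn2r ?nnegrE ?dW_ge0 ?sqrtr_ge0.
apply: le_lt_trans (dW_quasi_triangle dP eta nu nu' t0) _; rewrite -/A.
have h1 : t * A <= (r - A) / 2.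
  apply: (@le_trans _ _ (t * (A + 1))); first by rewrite ler_wpM2l ?ltW// ltrDl.
  by rewrite /t le_eqVlt; apply/orP; left; apply/eqP; field; rewrite gt_eqF.
have h2 : 2 * (1 + t^-1) * dW nu nu' ^+ 2 < (r - A) / 2.
  have <- : 2 * (1 + t^-1) * b = (r - A) / 2.
    by rewrite /b; field; rewrite !gt_eqF//=; lra.
  by rewrite ltr_pM2l//; lra.
by rewrite mulrDl mul1r; lra.
Qed.

Lemma measurable_dW_sq (eta : W2 d) :
  measurable_fun setT (fun nu : borel (@dW R T d) => dW eta nu ^+ 2).
Proof.
apply: measurable_fun_ltP => r; apply: measurable_dopen; exact: dopen_dW_sq.
Qed.

Lemma W2_W2_moment_lt (P : W2 (@dW R T d)) (mu : W2 d) :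
  (\int[P]_nu (dW mu nu ^+ 2)%:E < +oo)%E.
Proof.
have [nu0 h] := W2_moment P.
have [a aE] : exists a, (\int[P]_nu (dW nu0 nu ^+ 2)%:E = a%:E)%E.
  exists (fine (\int[P]_x (dW nu0 x ^+ 2)%:E)); rewrite fineK// ge0_fin_numE//.
  by apply: integral_ge0 => x _; rewrite lee_fin sqr_ge0.
apply: le_lt_trans (ltry (4 * a + 0 * a + 2 * dW mu nu0 ^+ 2)).
apply: (@integral_le_linear _ _ (borel (@dW R T d)) P (fun nu => dW nu0 nu ^+ 2)
  (fun nu => dW nu0 nu ^+ 2)) => //.
- exact: sprobability_setT.
- exact: measurable_dW_sq.
- exact: measurable_dW_sq.
- exact: measurable_dW_sq.
- by move=> z; exact: sqr_ge0.
- by move=> z; exact: sqr_ge0.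
- by move=> z; exact: sqr_ge0.
- by rewrite mulr_ge0 ?sqr_ge0.
- exists set0 => // nu _; have := dW_quasi_triangle dP mu nu0 nu ltr01.
  by rewrite invr1; lra.
- by rewrite aE.
- by rewrite aE.
Qed.

Lemma ex_mixture (eta1 eta2 : W2 d) (l : R) : 0 <= l <= 1 ->
  exists eta : W2 d, forall A, eta A = (l%:E * eta1 A + (1 - l)%:E * eta2 A)%E.
Proof.
move=> /andP[l0 l1]; have l10 : 0 <= 1 - l by rewrite subr_ge0.
have [n1 n1E n1i] := ex_scale eta1 l0. have [n2 n2E n2i] := ex_scale eta2 l10.
have [n nE ni] := ex_add n1 n2.
have nT : n setT = 1%E.
  rewrite nE n1E n2E; transitivity (l%:E * 1 + (1 - l)%:E * 1)%E.
    by congr (_ * _ + _ * _)%E; exact: probability_setT.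
  by rewrite !mule1 -EFinD addrC subrK.
have [p pE] := ex_probability nT.
have mp : finite_second_moment (d := d) p.
  exists point; rewrite pE.
  have mk : measurable_fun setT (fun y : borel d => (d point y ^+ 2)%:E).
    by apply/measurable_EFinP; exact: measurable_sqdistl.
  have k0 (y : borel d) : (0 <= (d point y ^+ 2)%:E)%E by rewrite lee_fin sqr_ge0.
  rewrite ni// n1i// n2i//; apply: lte_add_pinfty.
    by apply: lte_mul_pinfty => //; exact: W2_moment_lt.
  by apply: lte_mul_pinfty => //; exact: W2_moment_lt.
by exists (MkW2 mp) => A; rewrite /= pE nE n1E n2E.
Qed.

Lemma dW_mixture_le (eta1 eta2 nu1 nu2 eta nu : W2 d) (l : R) pi1 pi2 : 0 <= l <= 1 ->
  (forall A, measurable A -> eta A = (l%:E * eta1 A + (1 - l)%:E * eta2 A)%E) ->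
  (forall A, measurable A -> nu A = (l%:E * nu1 A + (1 - l)%:E * nu2 A)%E) ->
  coupling eta1 nu1 pi1 -> coupling eta2 nu2 pi2 ->
  ((dW eta nu ^+ 2)%:E <=
    l%:E * transport_cost pi1 + (1 - l)%:E * transport_cost pi2)%E.
Proof.
move=> /andP[l0 l1] etaE nuE c1 c2; have l10 : 0 <= 1 - l by rewrite subr_ge0.
have [n1 n1E n1i] := ex_scale pi1 l0. have [n2 n2E n2i] := ex_scale pi2 l10.
have [n nE ni] := ex_add n1 n2.
have nT : n setT = 1%E.
  rewrite nE n1E n2E; transitivity (l%:E * 1 + (1 - l)%:E * 1)%E.
    by congr (_ * _ + _ * _)%E; exact: probability_setT.
  by rewrite !mule1 -EFinD addrC subrK.
have [p pE] := ex_probability nT.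
have cp : coupling eta nu p.
  move=> A mA; rewrite /pushforward pE !nE !n1E !n2E etaE// nuE//.
  by have [<- <-] := c1 _ mA; have [<- <-] := c2 _ mA.
apply: le_trans (dW_sq_le dP cp) _.
have mk : measurable_fun setT (fun z : borel D => (d z.1 z.2 ^+ 2)%:E).
  by apply/measurable_EFinP; exact: measurable_sqdist.
have k0 (z : borel D) : (0 <= (d z.1 z.2 ^+ 2)%:E)%E by rewrite lee_fin sqr_ge0.
by rewrite /transport_cost pE ni// n1i// n2i.
Qed.

Section restriction_of_plan.
Context (mu nu : W2 d) (m : probability (borel d) R) (g : borel d -> R).
Context (pi : probability (borel D) R).
Hypotheses (gm : bounded_density mu m g) (cpi : coupling mu nu pi).

Let mg : measurable_fun setT (fun z : borel D => g z.1).
Proof. by case: gm => mg _ _ _;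
  exact: measurableT_comp mg (@measurable_fst_borel _ _ _). Qed.

Let g0 (z : borel D) : 0 <= g z.1.
Proof. by case: gm => _ + _ _; exact. Qed.

Lemma restrictedE (A : set (borel d)) : measurable A ->
  W2_restricted gm cpi A = (\int[pi]_z (\1_(snd @^-1` A : set (borel D)) z * g
    z.1)%:E)%E.
Proof.
move=> mA; transitivity (\int[pi]_(z in snd @^-1` A) (g z.1)%:E)%E; first by [].
rewrite integral_mkcond.
apply: eq_integral => z _; rewrite patchE indicE.
by case: ifP => _; rewrite ?mul1r ?mul0r.
Qed.

(** The plan restricted to the density [g] couples [m] with the restriction of
    [nu]. *)
Lemma dW_density_restricted_le :
  ((dW (W2_density gm) (W2_restricted gm cpi) ^+ 2)%:E <=
   \int[pi]_z (d z.1 z.2 ^+ 2 * g z.1)%:E)%E.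
Proof.
have [n nE] := ex_density pi mg g0.
have nm (A : set (borel d)) : measurable A -> n (fst @^-1` A) = m A.
  move=> mA; have [mg' g0' _ ->//] := gm.
  rewrite nE /mdensity integral_mkcond [RHS]integral_mkcond.
  rewrite -(coupling_integral_fst cpi)//.
  - by apply/(measurable_restrictT _ mA); apply: measurable_funTS;
    apply/measurable_EFinP.
  - by apply: erestrict_ge0 => z _; rewrite lee_fin.
have nr (A : set (borel d)) : measurable A -> n (snd @^-1` A) = W2_restricted gm cpi A.
  by move=> mA; rewrite nE.
have [p cp pii] := ex_coupling_pushforward dP (@measurable_fst_borel _ _ _)
  (@measurable_snd_borel _ _ _) nm nr.
apply: le_trans (dW_sq_le (mu := W2_density gm) dP cp) _.
have mk : measurable_fun setT (fun z : borel D => (d z.1 z.2 ^+ 2)%:E).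
  by apply/measurable_EFinP; exact: measurable_sqdist.
have k0 (z : borel D) : (0 <= (d z.1 z.2 ^+ 2)%:E)%E by rewrite lee_fin sqr_ge0.
rewrite /transport_cost pii// (ge0_integral_density (m := pi) mg g0)//.
by move=> A _; rewrite nE.
Qed.
End restriction_of_plan.

Section decomposition.
Context (mu : W2 d) (l : R) (mu1 mu2 : probability (borel d) R).
Context (g1 g2 : borel d -> R).
Hypotheses (l01 : 0 < l < 1)
  (mu_dec : forall A : set (borel d), measurable A ->
     mu A = (l%:E * mu1 A + (1 - l)%:E * mu2 A)%E)
  (gm1 : bounded_density mu mu1 g1) (gm2 : bounded_density mu mu2 g2).

Let l0 : 0 <= l. Proof. by case/andP: l01 => /ltW. Qed.
Let l10 : 0 <= 1 - l. Proof. by case/andP: l01 => _ /ltW; rewrite subr_ge0. Qed.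

Lemma decomposition_density :
  ae_eq mu setT (fun x => (l * g1 x + (1 - l) * g2 x)%:E) (cst 1%E).
Proof.
have [mg1 g10 _ E1] := gm1; have [mg2 g20 _ E2] := gm2.
have mG : measurable_fun setT (fun x => l * g1 x + (1 - l) * g2 x).
  exact: measurable_linear.
have intE A : measurable A ->
  (\int[mu]_(x in A) (l * g1 x + (1 - l) * g2 x)%:E = mu A)%E.
  move=> mA; rewrite mu_dec// E1// E2// /mdensity.
  under eq_integral do rewrite EFinD !EFinM.
  rewrite ge0_integralD//.
  - rewrite !ge0_integralZl_EFin//.
    + by move=> x _; rewrite lee_fin.
    + by apply: measurable_funTS; exact/measurable_EFinP.
    + by move=> x _; rewrite lee_fin.
    + by apply: measurable_funTS; exact/measurable_EFinP.
  - by move=> x _; rewrite mule_ge0 ?lee_fin.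
  - by apply: emeasurable_funM => //; apply: measurable_funTS; exact/measurable_EFinP.
  - by move=> x _; rewrite mule_ge0 ?lee_fin.
  - by apply: emeasurable_funM => //; apply: measurable_funTS; exact/measurable_EFinP.
apply: integral_ae_eq => //.
- apply/integrableP; split; first exact/measurable_EFinP.
  under eq_integral do rewrite gee0_abs ?lee_fin ?addr_ge0 ?mulr_ge0//.
  by rewrite intE// probability_setT ltry.
- by move=> E _ mE; rewrite intE// integral_cst// mul1e.
Qed.

Lemma integral_decomposition (nu : W2 d) pi (k : borel D -> R) : coupling mu nu pi ->
  measurable_fun setT k -> (forall z, 0 <= k z) ->
  (\int[pi]_z (k z)%:E = l%:E * \int[pi]_z (k z * g1 z.1)%:E +
    (1 - l)%:E * \int[pi]_z (k z * g2 z.1)%:E)%E.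
Proof.
move=> cpi mk k0.
have [mg1 g10 _ E1] := gm1; have [mg2 g20 _ E2] := gm2.
have mg1' := measurableT_comp mg1 (@measurable_fst_borel _ _ d).
have mg2' := measurableT_comp mg2 (@measurable_fst_borel _ _ d).
rewrite -(integral_linear pi (f := fun z => k z * g1 z.1) (g := fun z =>
  k z * g2 z.1))//; last 4 first.
- exact: measurable_funM.
- exact: measurable_funM.
- by move=> z; rewrite mulr_ge0.
- by move=> z; rewrite mulr_ge0.
apply: ge0_ae_eq_integral => //.
- exact/measurable_EFinP.
- apply/measurable_EFinP; apply: measurable_funD; apply: measurable_funM => //;
  exact: measurable_funM.
- by move=> z _; rewrite lee_fin.
- by move=> z _; rewrite lee_fin addr_ge0// !mulr_ge0.
have [N [mN N0 NP]] := decomposition_density.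
exists (fst @^-1` N); split.
- by rewrite -[X in measurable X]setTI; exact: measurable_fst_borel.
- by have [+ _] := cpi _ mN; rewrite /pushforward N0.
- move=> z /= hz; apply: NP => /= h; apply: hz => _.
  have [e] : (l * g1 z.1 + (1 - l) * g2 z.1)%:E = 1%E := h I.
  by rewrite !(mulrCA _ (k z)) -mulrDr e mulr1.
Qed.

Lemma restricted_decomposition (nu : W2 d) pi (cpi : coupling mu nu pi) A :
  measurable A ->
  nu A = (l%:E * W2_restricted gm1 cpi A + (1 - l)%:E * W2_restricted gm2 cpi A)%E.
Proof.
move=> mA; rewrite !restrictedE//.
have mA2 : measurable (snd @^-1` A : set (borel D)).
  by rewrite -[X in measurable X]setTI; exact: measurable_snd_borel.
rewrite -(integral_decomposition cpi)//.
by rewrite integral_indic// setIT -(cpi _ mA).2.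
Qed.

Lemma dW_decomposition_le (nu : W2 d) pi (cpi : coupling mu nu pi) :
  optimal_coupling mu nu pi ->
  l * dW (W2_density gm1) (W2_restricted gm1 cpi) ^+ 2 +
  (1 - l) * dW (W2_density gm2) (W2_restricted gm2 cpi) ^+ 2 <= dW mu nu ^+ 2.
Proof.
move=> opi; rewrite -lee_fin (dW_sq_optimal dP opi) /transport_cost.
have sq0 (z : borel D) : 0 <= d z.1 z.2 ^+ 2 by exact: sqr_ge0.
have -> := integral_decomposition cpi (measurable_sqdist dP) sq0.
have h1 := dW_density_restricted_le gm1 cpi.
have h2 := dW_density_restricted_le gm2 cpi.
move: (dW (W2_density gm1) _ ^+ 2) h1 => u1 h1.
move: (dW (W2_density gm2) _ ^+ 2) h2 => u2 h2.
by rewrite EFinD !EFinM; apply: leeD; exact: lee_wpmul2l.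
Qed.
End decomposition.

Section measurability.
Context (pi : W2 d -> W2 d -> W2 D).
Hypotheses (mpi : measurable_fun [set: borel (prod_dist (@dW R T d) (@dW R T d))]
     (fun p : borel (prod_dist (@dW R T d) (@dW R T d)) =>
        (pi p.1 p.2 : borel (@dW R _ D)))).
Hypothesis opt_pi : forall mu nu : W2 d, optimal_coupling mu nu (pi mu nu).
Context (mu : W2 d) (m : probability (borel d) R) (g : borel d -> R).
Context (gm : bounded_density mu m g).

Lemma measurable_restriction : measurable_fun setT
  (restriction gm (fun nu => (opt_pi mu nu).1) : borel (@dW R T d) ->
    borel (@dW R T d)).
Proof.
set Rm := restriction _ _.
have mpair : measurable_fun setT (fun nu : borel (@dW R T d) =>
    (mu, nu) : borel (prod_dist (@dW R T d) (@dW R T d))).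
  apply: measurable_fun_borel => U dU; apply: measurable_dopen => nu /dU[e e0 eU].
  exists e => // nu' h; apply: eU; rewrite /prod_dist/= (dW_refl dP) expr0n/= add0r.
  by rewrite sqrtr_sqr ger0_norm ?dW_ge0.
have mpimu := measurableT_comp mpi mpair.
apply: measurable_fun_borel => U dU.
pose V : set (W2 D) := [set ga | exists2 e : R, 0 < e &
  forall nu, dW ga (pi mu nu) < e -> U (Rm nu)].
(* Testing [V] only against the plans [pi mu nu], which all have first marginal
   [mu], makes it open in the whole space of plans. *)
have dV : dopen (@dW R _ D) V.
  move=> ga [e e0 eU]; exists (e / 3); first by rewrite divr_gt0.
  move=> ga' gaga'; exists (e / 3); first by rewrite divr_gt0.
  move=> nu ga'nu; apply: eU.
  rewrite -(@ltr_pXn2r _ 2)// ?nnegrE ?dW_ge0 ?ltW//.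
  apply: le_lt_trans (dW_quasi_triangle DP ga ga' (pi mu nu) ltr01) _.
  have h1 : dW ga ga' ^+ 2 < (e / 3) ^+ 2.
    by rewrite ltr_pXn2r ?nnegrE ?dW_ge0 ?divr_ge0// ltW.
  have h2 : dW ga' (pi mu nu) ^+ 2 < (e / 3) ^+ 2.
    by rewrite ltr_pXn2r ?nnegrE ?dW_ge0 ?divr_ge0// ltW.
  have e9 : (e / 3) ^+ 2 = e ^+ 2 / 9 by field.
  have e20 : 0 < e ^+ 2 by rewrite exprn_gt0.
  by rewrite invr1; rewrite {}e9 in h1 h2; lra.
rewrite (_ : Rm @^-1` U = (fun nu => pi mu nu) @^-1` V).
  by rewrite -[X in measurable X]setTI; apply: mpimu => //; exact: measurable_dopen.
apply/seteqP; split => nu /=; last first.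
  by move=> [e e0]; apply; rewrite (dW_refl DP).
move=> /dU[e e0 eU].
have [a a0 aP] := restricted_continuous dP gm (opt_pi mu nu).1 e0.
by exists a => // nu' /(aP _ _ (opt_pi mu nu').1); exact: eU.
Qed.
End measurability.

(** The statement for the first of the two parts of the decomposition, over an
    arbitrary separable pseudometric. *)
Lemma restriction_barycenter (pi : W2 d -> W2 d -> W2 D)
  (mpi : measurable_fun [set: borel (prod_dist (@dW R T d) (@dW R T d))]
     (fun p : borel (prod_dist (@dW R T d) (@dW R T d)) =>
        (pi p.1 p.2 : borel (@dW R _ D))))
  (opt_pi : forall mu nu : W2 d, optimal_coupling mu nu (pi mu nu))
  (mu : W2 d) (l : R) (l01 : 0 < l < 1) (mu1 mu2 : probability (borel d) R)
  (mu_dec : forall A : set (borel d), measurable A ->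
     mu A = (l%:E * mu1 A + (1 - l)%:E * mu2 A)%E)
  (g1 g2 : borel d -> R)
  (gm1 : bounded_density mu mu1 g1) (gm2 : bounded_density mu mu2 g2)
  (P : W2 (@dW R T d)) :
  exists Q : W2 (@dW R T d),
    is_pushforward (restriction gm1 (fun nu => (opt_pi mu nu).1)
      : borel (@dW R T d) -> borel (@dW R T d)) P Q /\
    (is_barycenter P mu -> is_barycenter Q (W2_density gm1)).
Proof.
have /andP[l0 l1] := l01.
have l10 : 0 < 1 - l by rewrite subr_gt0.
have mR1 := measurable_restriction mpi opt_pi gm1.
have mR2 := measurable_restriction mpi opt_pi gm2.
set R1 := restriction gm1 _ in mR1 *; set R2 := restriction gm2 _ in mR2.
pose a (eta nu : W2 d) := dW eta (R1 nu) ^+ 2.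
pose b nu := dW (W2_density gm2) (R2 nu) ^+ 2.
have ma eta : measurable_fun setT (a eta : borel (@dW R T d) -> R).
  exact: measurableT_comp (measurable_dW_sq eta) mR1.
have mb : measurable_fun setT (b : borel (@dW R T d) -> R).
  exact: measurableT_comp (measurable_dW_sq _) mR2.
have a0 eta nu : 0 <= a eta nu by exact: sqr_ge0.
have b0 nu : 0 <= b nu by exact: sqr_ge0.
have mdW eta : measurable_fun setT (fun nu : borel (@dW R T d) => (dW eta nu ^+ 2)%:E).
  by apply/measurable_EFinP; exact: measurable_dW_sq.
have dW0 (eta nu : W2 d) : (0 <= (dW eta nu ^+ 2)%:E)%E by rewrite lee_fin sqr_ge0.
have lower nu : l * a (W2_density gm1) nu + (1 - l) * b nu <= dW mu nu ^+ 2.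
  exact: (dW_decomposition_le l01 mu_dec gm1 gm2 (opt_pi mu nu).1 (opt_pi mu nu)).
have intlower : (l%:E * \int[P]_nu (a (W2_density gm1) nu)%:E +
    (1 - l)%:E * \int[P]_nu (b nu)%:E <= \int[P]_nu (dW mu nu ^+ 2)%:E)%E.
  rewrite -(integral_linear P (ma _) mb (a0 _) b0 (ltW l0) (ltW l10)).
  apply: ge0_le_integral => //.
  - by move=> nu _; rewrite lee_fin; apply: addr_ge0; apply: mulr_ge0 => //; exact: ltW.
  - apply/measurable_EFinP; exact: measurable_linear _ _ (ma _) mb.
  - by move=> nu _; rewrite lee_fin.
have inta0 eta : (0 <= \int[P]_nu (a eta nu)%:E)%E.
  by apply: integral_ge0 => nu _; rewrite lee_fin.
have intb0 : (0 <= \int[P]_nu (b nu)%:E)%E.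
  by apply: integral_ge0 => nu _; rewrite lee_fin.
have intsum_lt : (l%:E * \int[P]_nu (a (W2_density gm1) nu)%:E +
    (1 - l)%:E * \int[P]_nu (b nu)%:E < +oo)%E.
  by apply: le_lt_trans intlower _; exact: W2_W2_moment_lt.
have l0E : (0 <= l%:E)%E by rewrite lee_fin ltW.
have l10E : (0 <= (1 - l)%:E)%E by rewrite lee_fin ltW.
have [Qm QmE Qmi] := ex_pushforward P mR1.
have QmT : Qm setT = 1%E by rewrite QmE preimage_setT; exact: probability_setT.
have [Qp QpE] := ex_probability QmT.
have mQ : finite_second_moment (d := @dW R T d) Qp.
  exists (W2_density gm1); rewrite QpE Qmi//.
  have : (l%:E * \int[P]_nu (a (W2_density gm1) nu)%:E < +oo)%E.
    by apply: le_lt_trans intsum_lt; exact: leeDl (mule_ge0 l10E intb0).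
  move: (inta0 (W2_density gm1)).
  change (\int[P]_x (dW (W2_density gm1) (R1 x) ^+ 2)%:E)%E
    with (\int[P]_nu (a (W2_density gm1) nu)%:E)%E.
  by case: (\int[P]_nu _)%E => [r| |]// _; rewrite ?ltry// gt0_muley ?lte_fin.
exists (MkW2 mQ); split; first by split => // A mA; rewrite /= QpE QmE.
move=> bary eta1.
have QE eta : (\int[Qp]_nu (dW eta nu ^+ 2)%:E = \int[P]_nu (a eta nu)%:E)%E.
  by rewrite QpE (Qmi _ (mdW eta) (dW0 eta)).
suff main : (\int[P]_nu (a (W2_density gm1) nu)%:E <= \int[P]_nu (a eta1 nu)%:E)%E.
  by rewrite -(QE (W2_density gm1)) -(QE eta1) in main; exact: main.
have l01' : 0 <= l <= 1 by rewrite !ltW.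
have [eta etaE] := ex_mixture eta1 (W2_density gm2) l01'.
have upper nu : dW eta nu ^+ 2 <= l * a eta1 nu + (1 - l) * b nu.
  rewrite -lee_fin EFinD (EFinM l) (EFinM (1 - l)) /a /b.
  rewrite (dW_sq_optimal dP (opt_pi eta1 (R1 nu))).
  rewrite (dW_sq_optimal dP (opt_pi (W2_density gm2) (R2 nu))).
  apply: (dW_mixture_le (eta1 := eta1) (eta2 := W2_density gm2)
    (nu1 := R1 nu) (nu2 := R2 nu)) => //.
  - by move=> A mA; exact: (restricted_decomposition l01 mu_dec gm1 gm2 (opt_pi mu
    nu).1).
  - by have [] := opt_pi eta1 (R1 nu).
  - by have [] := opt_pi (W2_density gm2) (R2 nu).
have intupper : (\int[P]_nu (dW eta nu ^+ 2)%:E <=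
    l%:E * \int[P]_nu (a eta1 nu)%:E + (1 - l)%:E * \int[P]_nu (b nu)%:E)%E.
  rewrite -(integral_linear P (ma _) mb (a0 _) b0 (ltW l0) (ltW l10)).
  apply: ge0_le_integral => //.
  - apply/measurable_EFinP; exact: measurable_linear _ _ (ma _) mb.
  - by move=> nu _; rewrite lee_fin.
have key := le_trans intlower (le_trans (bary eta) intupper).
have lbfin : ((1 - l)%:E * \int[P]_nu (b nu)%:E \is a fin_num)%E.
  rewrite ge0_fin_numE; last exact: mule_ge0 l10E intb0.
  by apply: le_lt_trans intsum_lt; exact: leeDr (mule_ge0 l0E (inta0 _)).
by rewrite (leeD2rE _ _ lbfin) in key; rewrite lee_pmul2l in key.
Qed.
End barycenter.

Theorem proposition3p4 (R : realType) (X : completeMetricType R)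
  (sepX : separable_space X) (properX : proper_metric X)
  (pi : W2 (@mdist R X) -> W2 (@mdist R X) ->
        W2 (prod_dist (@mdist R X) (@mdist R X)))
  (mpi : measurable_fun [set: borel (prod_dist (@dW R X mdist) (@dW R X mdist))]
     (fun p : borel (prod_dist (@dW R X mdist) (@dW R X mdist)) =>
        (pi p.1 p.2 : borel (@dW R (X * X)%type (prod_dist mdist mdist)))))
  (opt_pi : forall mu nu : W2 (@mdist R X), optimal_coupling mu nu (pi mu nu))
  (mu : W2 (@mdist R X)) (lambda : R) (lambda01 : 0 < lambda < 1)
  (mu1 mu2 : probability (borel (@mdist R X)) R)
  (mu_dec : forall A : set (borel (@mdist R X)), measurable A ->
     mu A = (lambda%:E * mu1 A + (1 - lambda)%:E * mu2 A)%E)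
  (g1 g2 : borel (@mdist R X) -> R)
  (mu1_g1 : bounded_density mu mu1 g1) (mu2_g2 : bounded_density mu mu2 g2)
  (P : W2 (@dW R X mdist)) :
  let R1 := restriction mu1_g1 (fun nu => (opt_pi mu nu).1) in
  let R2 := restriction mu2_g2 (fun nu => (opt_pi mu nu).1) in
  (exists Q1 : W2 (@dW R X mdist),
     is_pushforward (R1 : borel (@dW R X mdist) -> borel (@dW R X mdist)) P Q1 /\
     (is_barycenter P mu -> is_barycenter Q1 (W2_density mu1_g1))) /\
  (exists Q2 : W2 (@dW R X mdist),
     is_pushforward (R2 : borel (@dW R X mdist) -> borel (@dW R X mdist)) P Q2 /\
     (is_barycenter P mu -> is_barycenter Q2 (W2_density mu2_g2))).
Proof.
move=> R1 R2; have dP := separable_pseudometric_mdist sepX; split.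
  exact: (restriction_barycenter dP mpi opt_pi lambda01 mu_dec mu1_g1 mu2_g2 P).
(* The statement for mu2 is the one for mu1 after exchanging the two parts of
   the decomposition, so with weight 1 - lambda. *)
have l01 : 0 < 1 - lambda < 1.
  by case/andP: lambda01 => l0 l1; rewrite subr_gt0 l1 gtrBl.
have mu_dec' A : measurable A ->
    mu A = ((1 - lambda)%:E * mu2 A + (1 - (1 - lambda))%:E * mu1 A)%E.
  by move=> mA; rewrite mu_dec// subKr addeC.
exact: (restriction_barycenter dP mpi opt_pi l01 mu_dec' mu2_g2 mu1_g1 P).
Qed.
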